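(* Assume the non-lattice case and suppose that $$\int_{[0,\infty)}\bigl(1-F_\mu(x)\bigr)^2\,dx<\infty .$$ Then, for every starting point $x>0$, the reflected random walk $(X_n^x)$ is topologically recurrent: for every (non-empty) bounded open interval $J\subset C$, $$\Pr\left[\sum_{n=0}^{\infty}\mathbf{1}_J(X_n^x)=\infty\right]=1 .$$ If in addition $\mathsf{E}(Y_1)=\int_{[0,\infty)}x\,\mu(dx)<\infty$, then $(X_n^x)$ is positive recurrent, while it is null recurrent when $\mathsf{E}(Y_1)=\infty$.
   Context: Let $(Y_n)_{n\ge 1}$ be i.i.d. non-constant, non-negative real random variables with common distribution $\mu$ and distribution function $F_\mu(x)=\mu([0,x])$. Non-lattice case: there is no $\kappa>0$ with $\operatorname{supp}(\mu)\subset\kappa\cdot\mathbb{N}_0$, where $\mathbb{N}_0=\{0,1,2,\dots\}$. Let $N=\sup\operatorname{supp}(\mu)$, and $C=[0,N]$ if $N<\infty$, $C=[0,\infty)$ if $N=\infty$. Reflected random walk started at $x\ge0$ is $X_0^x=x$, $X_{n+1}^x=|X_n^x-Y_{n+1}|$; it is absorbed by $C$ after finitely many steps. The measure $\nu(dx)=\bigl(1-F_\mu(x)\bigr)\,dx$ on $C$ is known to be invariant for it, and in the recurrent case it is known to be the unique invariant Radon measure on $C$ up to multiplication with constants. Positive recurrent means (topologically) recurrent with an invariant Radon measure on $C$ of finite total mass; null recurrent means (topologically) recurrent with the invariant Radon measure having infinite total mass. *)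

(* Defs.v *)
From HB Require Import structures.
From mathcomp Require Import all_boot all_order all_algebra.
From mathcomp Require Import all_classical all_reals all_analysis.

Set Implicit Arguments.
Unset Strict Implicit.
Unset Printing Implicit Defensive.

Import Order.TTheory GRing.Theory Num.Theory.
Import numFieldNormedType.Exports.

Local Open Scope classical_set_scope.
Local Open Scope ring_scope.
Local Open Scope ereal_scope.

Section iid.
Context d (Omega : measurableType d) (R : realType) (P : probability Omega R).

(* Mutual independence: the product rule over every finite set of indices. *)
Definition independent_seq (Y : nat -> {RV P >-> R}) : Prop :=
  forall s : seq nat, uniq s ->
  forall A : nat -> set R, (forall i, measurable (A i)) ->
  P (\bigcap_(i in [set` s]) (Y i @^-1` A i)) =
  \prod_(i <- s) P (Y i @^-1` A i).

Definition iid_with_law (mu : probability R R) (Y : nat -> {RV P >-> R}) :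
    Prop :=
  independent_seq Y /\
  forall n (A : set R), measurable A -> distribution P (Y n) A = mu A.

End iid.

Section law.
Context (R : realType) (mu : probability R R).

Definition supp : set R :=
  [set x | forall U : set R, open U -> U x -> 0 < mu U].

Definition non_lattice : Prop :=
  ~ exists kappa : R,
      (0 < kappa)%R /\ supp `<=` [set (kappa * n%:R)%R | n in [set: nat]].

Definition distr_fun (x : R) : R := fine (mu `[0%R, x]%classic).

Definition sup_supp : \bar R := ereal_sup [set x%:E | x in supp].

(* The state space: [0, N] if N = sup_supp is finite, [0, +oo[ otherwise. *)
Definition absorbing_set : set R :=
  [set x | (0 <= x)%R /\ x%:E <= sup_supp].

(* Pr[|x - Y_1| \in A] when Y_1 has law mu. *)
Definition transition (x : R) (A : set R) : \bar R :=
  mu [set y | A `|x - y|%R].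

(* Nonzero invariant Radon measures on absorbing_set, viewed as Borel measures
   on R that vanish outside it.  On R, a Borel measure which is finite on
   compact sets is regular, hence Radon. *)
Definition invariant_radon (nu : {measure set R -> \bar R}) : Prop :=
  [/\ nu (~` absorbing_set) = 0,
      nu absorbing_set != 0,
      forall K : set R, compact K -> nu K < +oo &
      forall A : set R, measurable A ->
        nu A = \int[nu]_(x in absorbing_set) transition x A].

End law.

Section reflected_random_walk.
Context d (Omega : measurableType d) (R : realType) (P : probability Omega R).
Context (mu : probability R R) (Y : nat -> {RV P >-> R}).

(* The increments are indexed from 0: Y n is the (n+1)-st one, so the step
   from time n to time n.+1 uses Y n. *)
Fixpoint reflected_rw (x : R) (n : nat) (w : Omega) : R :=
  if n is m.+1 then `|reflected_rw x m w - Y m w|%R else x.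

Definition topologically_recurrent (x : R) : Prop :=
  forall a b : R, (a < b)%R -> `]a, b[%classic `<=` absorbing_set mu ->
  P [set w | \sum_(0 <= n <oo)
             (\1_(`]a, b[%classic) (reflected_rw x n w) : R)%:E = +oo]
  = 1.

Definition positive_recurrent (x : R) : Prop :=
  topologically_recurrent x /\
  exists nu : {measure set R -> \bar R},
    invariant_radon mu nu /\ nu (absorbing_set mu) < +oo.

(* "The" invariant Radon measure, unique up to constants, has infinite mass:
   one exists, and all of them have infinite mass. *)
Definition null_recurrent (x : R) : Prop :=
  [/\ topologically_recurrent x,
      exists nu : {measure set R -> \bar R}, invariant_radon mu nu &
      forall nu : {measure set R -> \bar R},
        invariant_radon mu nu -> nu (absorbing_set mu) = +oo].

End reflected_random_walk.

(* Main.v *)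
Require Import Defs.
From HB Require Import structures.
From mathcomp Require Import all_boot all_order all_algebra.
From mathcomp Require Import all_classical all_reals all_analysis.
From mathcomp Require Import measurable_realfun ring lra zify.

(** Let [mu] be the law of the increments and [T x = mu ]x, +oo[] its tail. The
    measure [tail_measure] with density [T] on the half-line is invariant
    ([tail_measure_invariant]): written as a mixture of Lebesgue measures on
    [[0, a[] it reduces to an identity for two increments [a] and [b] that is
    symmetric in them ([landing_sym]). Its total mass is the mean of [mu].

    Recurrence. Upward moves of the walk beyond a level [M] are reflections,
    and in the stationary regime the mass that passes from [[0, M]] above [M]
    in one step is at most the integral over [[0, M]] of [T x * T M]. As the
    square of [T] is integrable, this tends to 0 when [M] grows
    ([overshoot_cvg0]). But the mass that leaves a fixed interval [[0, c]] for
    ever must cross every level, so it is zero ([flux_le], [flux_eq0]): almost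
    every point of [[0, c]] returns to [[0, c]]. Two walks driven by the same
    increments never move apart, which turns this into the statement that every
    point of [[0, beta[], for [beta > c], returns to [[0, beta[]
    ([return_everywhere]). In the non-lattice case each open interval [W] of
    the state space is reached from every starting point: modulo a step [s] of
    the support, the reachable points form an orbit of a dense group
    ([reach_dense]). By compactness the probability to reach [W] within a given
    time is bounded below on [[0, beta[], and a walk that keeps coming back to
    [[0, beta[] cannot avoid [W] ([never_confined], [never_eq0]). The Markov
    property ([avoids_prob]) transfers this to the walk on the probability
    space.

    Positive and null recurrence. If the mean is finite, the tail measure is a
    finite invariant measure. Conversely, a finite invariant measure forces the
    mean to be finite: with [u] and [v] the values of [x] and [y] cut off at a
    level [L], integrating [u + v <= min(|x - y|, L) + 2 min(u, v)] against the
    invariant measure in [x] and [mu] in [y], two terms cancel by invariance,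
    and the rest bounds the truncated mean at [L] by a constant that does not
    depend on [L] ([clip_mean_bound], [positive_mean_lty]). *)

Set Implicit Arguments.
Unset Strict Implicit.
Unset Printing Implicit Defensive.

Import Order.TTheory GRing.Theory Num.Theory.
Import numFieldNormedType.Exports.

Local Open Scope classical_set_scope.
Local Open Scope ring_scope.
Local Open Scope ereal_scope.

(** * Integration preliminaries *)

Lemma adde_self_inj (R : realType) (s t : \bar R) :
  0 <= s -> 0 <= t -> s + s = t + t -> s = t.
Proof.
case: s => [s| |]; case: t => [t| |] => // _ _.
by move=> st; have /= e := congr1 fine st; congr (_%:E); lra.
Qed.

Section integration.
Context d (T : measurableType d) (R : realType).

Lemma cvg_integral_le1 (P : probability T R) (f_ : nat -> T -> \bar R)
    (f : T -> \bar R) :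
  (forall n, measurable_fun setT (f_ n)) -> (forall n x, 0 <= f_ n x <= 1) ->
  (forall x, f_ ^~ x @ \oo --> f x) ->
  \int[P]_x f_ n x @[n --> \oo] --> \int[P]_x f x.
Proof.
move=> mf f01 cf.
have mf' : measurable_fun setT f by apply: (emeasurable_fun_cvg f_).
have [] := @dominated_convergence _ _ _ P setT measurableT f_ f (cst 1) mf mf'.
- by apply: aeW => x _; exact: cf.
- exact: finite_measure_integrable_cst.
- apply: aeW => x n _ /=.
  by have /andP[? ?] := f01 n x; rewrite gee0_abs.
- by [].
Qed.

Lemma integralDcst (P : probability T R) (g : T -> \bar R) (k : \bar R) :
  measurable_fun setT g -> (forall x, 0 <= g x) -> 0 <= k ->
  \int[P]_x (g x + k) = \int[P]_x g x + k.
Proof.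
move=> mg g0 k0.
rewrite (@ge0_integralD _ _ _ P setT measurableT g (cst k))//.
by rewrite (integral_cst P measurableT) [X in _ * X]probability_setT mule1.
Qed.

Lemma integral_mrestr (m : {measure set T -> \bar R}) (D : set T)
    (mD : measurable D) (f : T -> \bar R) :
  measurable_fun setT f -> (forall x, 0 <= f x) ->
  \int[mrestr m mD]_x f x = \int[m]_(x in D) f x.
Proof.
move=> mf f0.
have mDC : measurable (~` D) by exact: measurableC.
rewrite (@ge0_negligible_integral _ _ _ (mrestr m mD) setT _ f mDC)//;
  last first.
  by have : m (~` D `&` D) = 0 by rewrite setICl measure0.
rewrite setTD setCK; apply: eq_measure_integral => A mA AD.
by have : m (A `&` D) = m A by rewrite setIidl.
Qed.

End integration.

(** * The transition operator and avoidance probabilities *)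

Section kernel.
Context (R : realType) (mu : probability R R).

Implicit Types (h : R -> \bar R) (x : R) (V J : set R).

(** [step_op h x] is the expectation of [h] after one step of the walk from
    [x], when the increment has law [mu]. *)
Definition step_op (h : R -> \bar R) (x : R) : \bar R :=
  \int[mu]_y h `|x - y|%R.

Lemma measurable_dist : measurable_fun setT (fun z : R * R => `|z.1 - z.2|%R).
Proof.
by apply: measurableT_comp => //; apply: measurable_funB.
Qed.

Lemma measurable_dist_pair (h : R -> \bar R) : measurable_fun setT h ->
  measurable_fun setT (fun z : R * R => h `|z.1 - z.2|%R).
Proof. by move=> mh; exact: (measurableT_comp mh measurable_dist). Qed.

Lemma measurable_step (h : R -> \bar R) (x : R) : measurable_fun setT h ->
  measurable_fun setT (fun y : R => h `|x - y|%R).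
Proof.
move=> mh; apply: (measurableT_comp mh).
by apply: measurableT_comp => //; apply: measurable_funB.
Qed.

Lemma step_op_ge0 h x : (forall z, 0 <= h z) -> 0 <= step_op h x.
Proof. by move=> h0; apply: integral_ge0 => y _. Qed.

Lemma measurable_step_op h : measurable_fun setT h -> (forall z, 0 <= h z) ->
  measurable_fun setT (step_op h).
Proof.
move=> mh h0.
have := (@measurable_fun_fubini_tonelli_F _ _ _ _ _ mu
  (fun z : R * R => h `|z.1 - z.2|%R) (measurable_dist_pair mh)
    (fun z => h0 _)).
by [].
Qed.

Lemma le_step_op h1 h2 x : measurable_fun setT h1 -> measurable_fun setT h2 ->
  (forall z, 0 <= h1 z) -> (forall z, (0 <= z)%R -> h1 z <= h2 z) ->
  step_op h1 x <= step_op h2 x.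
Proof.
move=> m1 m2 h10 h12; apply: ge0_le_integral => //; try exact: measurable_step.
by move=> y _; apply: h12.
Qed.

Lemma step_opD h1 h2 x : measurable_fun setT h1 -> measurable_fun setT h2 ->
  (forall z, 0 <= h1 z) -> (forall z, 0 <= h2 z) ->
  step_op (fun z => h1 z + h2 z) x = step_op h1 x + step_op h2 x.
Proof.
by move=> m1 m2 h10 h20; apply: ge0_integralD => //; exact: measurable_step.
Qed.

Lemma step_opZ h k x : measurable_fun setT h -> (forall z, 0 <= h z) ->
  0 <= k ->
  step_op (fun z => k * h z) x = k * step_op h x.
Proof. by move=> mh h0 k0; apply: ge0_integralZl => //;
  exact: measurable_step. Qed.

Lemma step_op_cst k x : step_op (cst k) x = k.
Proof. by rewrite /step_op (integral_cst mu measurableT k)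
  [X in _ * X]probability_setT mule1. Qed.

Lemma step_op_indic A x : measurable A ->
  step_op (fun z => (\1_A z)%:E) x = mu [set y | A `|x - y|%R].
Proof.
move=> mA; rewrite /step_op.
have -> : (fun y => (\1_A `|x - y|%R : R)%:E) =
    (fun y => (\1_[set y | A `|x - y|%R] y)%:E).
  by apply/funext => y; rewrite !indicE; congr ((_ : bool)%:R%:E);
    apply/idP/idP; rewrite !inE.
rewrite integral_indic//; first by rewrite setIT.
have mN : measurable_fun setT (fun y : R => `|x - y|%R).
  by apply: measurableT_comp => //; apply: measurable_funB.
by rewrite -[X in measurable X]setTI; exact: mN.
Qed.

(** [avoid V n x] is the probability that the first [n] positions of the walk
    started at [x], the position at time 0 included, lie outside [V]; it is
    defined through the first step, so that no path space is involved. *)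
Fixpoint avoid (V : set R) (n : nat) (x : R) : \bar R :=
  if n is m.+1 then (\1_(~` V) x)%:E * step_op (avoid V m) x else 1.

(** The probability never to be in [V], time 0 included. *)
Definition never (V : set R) (x : R) : \bar R := limn (avoid V ^~ x).

Section avoid_theory.
Variables (V : set R) (mV : measurable V).

Lemma avoid_ge0 n x : 0 <= avoid V n x.
Proof.
elim: n x => [|n IH] x //=.
by rewrite mule_ge0// ?lee_fin//; exact: step_op_ge0.
Qed.

Lemma measurable_avoid n : measurable_fun setT (avoid V n).
Proof.
elim: n => [|n IH] /=; first exact: measurable_cst.
apply: emeasurable_funM; last by apply: measurable_step_op => //;
  exact: avoid_ge0.
by apply/measurable_EFinP; apply: measurable_indic; exact: measurableC.
Qed.

Lemma indic_mule_le (A : set R) (x : R) (u : \bar R) : 0 <= u ->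
  (\1_A x)%:E * u <= u.
Proof.
by move=> u0; rewrite indicE; case: (_ \in _); rewrite ?mul1e ?mul0e.
Qed.

Lemma avoid_nonincreasing n x : avoid V n.+1 x <= avoid V n x.
Proof.
elim: n x => [|n IH] x.
  rewrite /= (le_trans (indic_mule_le _ _ _)) ?step_op_ge0//.
  by rewrite -[leRHS](step_op_cst 1 x).
rewrite [leLHS]/= [leRHS]/= lee_wpmul2l ?lee_fin//.
apply: (@le_step_op (avoid V n.+1) (avoid V n)) => //;
  try exact: measurable_avoid.
by move=> z; exact: avoid_ge0.
Qed.

Lemma avoid_le1 n x : avoid V n x <= 1.
Proof.
by elim: n => [//|n IH]; apply: le_trans (avoid_nonincreasing _ _) IH.
Qed.

Lemma avoid_antimono x : nonincreasing_seq (avoid V ^~ x).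
Proof. by apply/nonincreasing_seqP => n; exact: avoid_nonincreasing. Qed.

Lemma cvg_avoid x : avoid V n x @[n --> \oo] --> never V x.
Proof. by apply: ereal_nonincreasing_is_cvgn; exact: avoid_antimono. Qed.

Lemma never_le n x : never V x <= avoid V n x.
Proof.
apply: lime_le; first by apply/cvg_ex; exists (never V x); exact: cvg_avoid.
near=> m; apply: avoid_antimono; near: m; exact: nbhs_infty_ge.
Unshelve. all: by end_near. Qed.

Lemma never_ge0 x : 0 <= never V x.
Proof.
apply: lime_ge; first by apply/cvg_ex; exists (never V x); exact: cvg_avoid.
by near=> m; exact: avoid_ge0.
Unshelve. all: by end_near. Qed.

Lemma never_le1 x : never V x <= 1.
Proof. exact: (never_le 0). Qed.

Lemma measurable_never : measurable_fun setT (never V).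
Proof.
by apply: (emeasurable_fun_cvg (avoid V)) => [n|x _];
  [exact: measurable_avoid|exact: cvg_avoid].
Qed.

(** The first-step equation passes to the limit by dominated convergence. *)
Lemma neverE x : never V x = (\1_(~` V) x)%:E * step_op (never V) x.
Proof.
have c : avoid V n.+1 x @[n --> \oo] --> (\1_(~` V) x)%:E * step_op (never V) x.
  apply: cvgeZl => //.
  apply: (@cvg_integral_le1 _ _ _ mu (fun n y => avoid V n `|x - y|%R)).
  - by move=> n; apply: measurable_step; exact: measurable_avoid.
  - by move=> n y; rewrite avoid_ge0 avoid_le1.
  - by move=> y; exact: cvg_avoid.
have c2 : avoid V n.+1 x @[n --> \oo] --> never V x.
  by rewrite (cvg_shiftS (avoid V ^~ x)); exact: cvg_avoid.
by rewrite -(cvg_lim _ c2)// -(cvg_lim _ c).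
Qed.

End avoid_theory.

Lemma avoid_in V n x : V x -> avoid V n.+1 x = 0.
Proof.
by move=> Vx; rewrite /= indicE memNset ?mul0e//= => /(_ Vx).
Qed.

Lemma never_in V x : measurable V -> V x -> never V x = 0.
Proof.
move=> mV Vx; apply/eqP; rewrite eq_le never_ge0// andbT.
by rewrite -(avoid_in 0 Vx) never_le.
Qed.

(** Two walks driven by the same increments never move apart, since
    [u |-> `|u - y|] is 1-Lipschitz. Hence if every point within distance [e]
    of [J] lies in [V], a walk that starts within [e] of [p] enters [V] at the
    latest when the walk from [p] enters [J]. *)
Lemma avoid_coupling (J V : set R) (e : R) : measurable J -> measurable V ->
  (forall p z, (`|z - p| <= e)%R -> J p -> V z) ->
  forall n p z, (`|z - p| <= e)%R -> avoid V n z <= avoid J n p.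
Proof.
move=> mJ mV JV; elim=> [//|n IH] p z zp.
have [Vz|nVz] := pselect (V z); first by rewrite avoid_in// avoid_ge0.
have nJp : ~ J p by move=> /(JV _ _ zp).
rewrite /= !indicE !mem_set// !mul1e /step_op.
apply: ge0_le_integral => //.
- by move=> y _; exact: avoid_ge0.
- by apply: measurable_step; exact: measurable_avoid.
- by apply: measurable_step; exact: measurable_avoid.
- move=> y _; apply: IH.
  apply: le_trans (ler_dist_dist _ _) _.
  by rewrite (_ : z - y - (p - y) = z - p)%R//; ring.
Qed.

(** The same comparison for walks that are only required to avoid the sets from
    time 1 on: [step_op (never V) z] is the probability of no visit to [V] at
    the times 1, 2, ... *)
Lemma never_coupling (J V : set R) (e : R) : measurable J -> measurable V ->
  (forall p z, (`|z - p| <= e)%R -> J p -> V z) ->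
  forall p z, (`|z - p| <= e)%R -> step_op (never V) z <= step_op (never J) p.
Proof.
move=> mJ mV JV p z zp.
apply: ge0_le_integral => //.
- by move=> y _; exact: never_ge0.
- by apply: measurable_step; exact: measurable_never.
- by apply: measurable_step; exact: measurable_never.
- move=> y _; have zpy : (`| `|z - y| - `|p - y| | <= e)%R.
    apply: le_trans (ler_dist_dist _ _) _.
    by rewrite (_ : z - y - (p - y) = z - p)%R//; ring.
  apply: lee_lim; try by apply: ereal_nonincreasing_is_cvgn;
    exact: avoid_antimono.
  by near=> n; exact: (avoid_coupling mJ mV JV).
Unshelve. all: by end_near. Qed.

End kernel.

(** * Reflection and translation of Lebesgue measure *)

Section lebesgue.
Context (R : realType).
Local Notation leb := (@lebesgue_measure R).
Implicit Types (h : R -> \bar R) (u v w c : R).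

Lemma lebesgue_measure_reflection c (A : set R) : measurable A ->
  pushforward leb (fun x : R => c - x)%R A = leb A.
Proof.
have mr : measurable_fun setT (fun x : measurableTypeR R => (c - x)%R :
  measurableTypeR R).
  by apply: measurable_funB.
move=> mA.
apply/esym.
pose m := @measure_function_pushforward__canonical__measure_function_Measure
  _ _ _ _ _ leb _ mr.
apply: (@lebesgue_measure_unique _ m) => //= _ [[a b]] _ <-.
rewrite /pushforward/=.
rewrite (_ : _ @^-1` _ = `[(c - b)%R, (c - a)%R[%classic); last first.
  by apply/seteqP; split => x /=; rewrite !in_itv/= => /andP[? ?]; apply/andP;
    split; lra.
rewrite !lebesgue_measure_itv/= !lte_fin ltrD2l ltrN2.
by case: ifPn => // _; rewrite -!EFinB; congr (_%:E); ring.
Qed.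

Lemma integral_reflection c u v h : measurable_fun setT h ->
  (forall x, 0 <= h x) ->
  \int[leb]_(x in `[u, v]) h (c - x)%R =
  \int[leb]_(x in `[(c - v)%R, (c - u)%R]) h x.
Proof.
move=> mh h0.
pose r (x : measurableTypeR R) : measurableTypeR R := (c - x)%R.
have mr : measurable_fun setT r by apply: measurable_funB.
transitivity (\int[pushforward leb r]_(x in `[(c - v)%R, (c - u)%R]) h x).
  rewrite ge0_integral_pushforward//; last exact: measurable_funTS.
  congr (integral _ _ _); apply/seteqP; split => x /=;
    rewrite /r !in_itv/= => /andP[? ?];
    apply/andP; split; lra.
pose m := @measure_function_pushforward__canonical__measure_function_Measure
  _ _ _ _ _ leb _ mr.
apply: (@eq_measure_integral _ _ _ _ leb m) => A mA _.
exact: lebesgue_measure_reflection.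
Qed.

Lemma integral_translation c u v h : measurable_fun setT h ->
  (forall x, 0 <= h x) ->
  \int[leb]_(x in `[u, v]) h (x - c)%R =
  \int[leb]_(x in `[(u - c)%R, (v - c)%R]) h x.
Proof.
move=> mh h0.
have mo : measurable_fun setT (fun x : R => h (- x)%R).
  by apply: measurableT_comp.
have := @integral_reflection c u v (fun x => h (- x)%R) mo (fun=> h0 _).
under eq_integral do rewrite opprB.
move=> ->.
have := @integral_reflection 0 (c - v)%R (c - u)%R h mh h0.
under eq_integral do rewrite sub0r.
by move=> ->; rewrite !sub0r !opprB.
Qed.

Lemma integral_itv_split u v w h : measurable_fun setT h ->
  (forall x, 0 <= h x) -> (u <= v <= w)%R ->
  \int[leb]_(x in `[u, w]) h x =
  \int[leb]_(x in `[u, v]) h x + \int[leb]_(x in `[v, w]) h x.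
Proof.
move=> mh h0 /andP[uv vw].
rewrite -(@integral_itv_bndo_bndc _ (BLeft u) v); last exact: measurable_funTS.
rewrite -ge0_integral_setU//.
- congr (integral _ _ _); apply/seteqP; split => x /=; rewrite !in_itv/=.
    by move=> /andP[-> ->]; rewrite andbT; case: (ltP x v); [left|right].
  by case=> /andP[h1 h2]; apply/andP; split; lra.
- exact: measurable_funTS.
- apply/disj_set2P; rewrite -subset0 => x /= []; rewrite !in_itv/=.
  by move=> /andP[? ?] /andP[? ?]; lra.
Qed.

(** [landing h a b] integrates [h] over the positions reached by one step [b]
    from a point chosen with Lebesgue measure on [[0, a[]. *)
Definition landing h (a b : R) : \bar R :=
  \int[leb]_(x in `[0%R, a[) h `|x - b|%R.

(** Up to endpoints, for [a <= b] the step [b] reflects [[0, a[] onto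
    [[b - a, b]], and the step [a] sends [[0, a]] onto itself and [[a, b]] onto
    [[0, b - a]]; together the images cover [[0, a]] and [[0, b]] once each.
    This symmetrised identity is the reason why the tail measure is invariant.
*)
Lemma landing_sym h a b : measurable_fun setT h -> (forall x, 0 <= h x) ->
  (0 <= a)%R -> (0 <= b)%R ->
  landing h a b + landing h b a =
  \int[leb]_(x in `[0%R, a[) h x + \int[leb]_(x in `[0%R, b[) h x.
Proof.
move=> mh h0.
wlog ab : a b / (a <= b)%R.
  move=> H a0 b0; have [ab|/ltW ba] := leP a b; first exact: H.
  by rewrite [LHS]addeC [RHS]addeC; exact: H.
move=> a0 b0.
rewrite /landing !integral_itv_bndo_bndc; do ?exact: measurable_funTS;
  last first.
- by apply: measurable_funTS; apply: (measurableT_comp mh);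
    apply: measurableT_comp => //; apply: measurable_funB.
- by apply: measurable_funTS; apply: (measurableT_comp mh);
    apply: measurableT_comp => //; apply: measurable_funB.
rewrite (@integral_itv_split 0 a b (fun x => h `|x - a|%R)) ?a0 ?ab//;
  last first.
  by apply: (measurableT_comp mh); apply: measurableT_comp => //;
    apply: measurable_funB.
have -> : \int[leb]_(x in `[0%R, a]) h `|x - b|%R =
    \int[leb]_(x in `[(b - a)%R, b]) h x.
  transitivity (\int[leb]_(x in `[0%R, a]) h (b - x)%R).
    apply: eq_integral => x; rewrite inE /= in_itv/= => /andP[x0 xa].
    by rewrite distrC ger0_norm//; lra.
  by rewrite integral_reflection// subr0.
have -> : \int[leb]_(x in `[0%R, a]) h `|x - a|%R =
    \int[leb]_(x in `[0%R, a]) h x.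
  transitivity (\int[leb]_(x in `[0%R, a]) h (a - x)%R).
    apply: eq_integral => x; rewrite inE /= in_itv/= => /andP[x0 xa].
    by rewrite distrC ger0_norm//; lra.
  by rewrite integral_reflection// subr0 subrr.
have -> : \int[leb]_(x in `[a, b]) h `|x - a|%R =
    \int[leb]_(x in `[0%R, (b - a)%R]) h x.
  transitivity (\int[leb]_(x in `[a, b]) h (x - a)%R).
    apply: eq_integral => x; rewrite inE /= in_itv/= => /andP[x0 xa].
    by rewrite ger0_norm//; lra.
  by rewrite integral_translation// subrr.
rewrite (@integral_itv_split 0 (b - a)%R b h)//; last by apply/andP; split; lra.
by rewrite [LHS]addeC -[LHS]addeA.
Qed.

End lebesgue.

(** * The invariant measure with density the tail of the law *)

Section tail_measure_theory.
Context (R : realType) (mu : probability R R).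
Local Notation leb := (@lebesgue_measure R).
Implicit Types (h : R -> \bar R).

(** The tail measure is encoded as the first marginal of Lebesgue measure times
    [mu], restricted to the pairs [0 <= x < y]: its density is [x |-> mu ]x,
    +oo[] on the half-line, and both Fubini decompositions of its integrals are
    immediate. *)
Definition undergraph : set (measurableTypeR R * R) :=
  [set z | (0 <= z.1 < z.2)%R].

Lemma measurable_undergraph : measurable undergraph.
Proof.
rewrite (_ : undergraph = (fst @^-1` `[0%R, +oo[%classic) `&`
    ((fun z : measurableTypeR R * R => z.2 - z.1)%R @^-1` `]0%R, +oo[%classic)).
  apply: measurableI; rewrite -[X in measurable X]setTI.
    exact: measurable_fst.
  have mB : measurable_fun setT (fun z : measurableTypeR R * R => z.2 - z.1)%R.
    by apply: measurable_funB.
  exact: mB.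
apply/seteqP; split => z /=; rewrite !in_itv/= !andbT subr_gt0.
  by move=> /andP[].
by move=> [? ?]; apply/andP.
Qed.

Lemma measurable_indic_undergraph :
  measurable_fun setT (\1_undergraph : measurableTypeR R * R -> R).
Proof. by apply: measurable_indic; exact: measurable_undergraph. Qed.

Definition tail_measure : {measure set R -> \bar R} :=
  @measure_function_pushforward__canonical__measure_function_Measure
    _ _ _ _ _ (mrestr (leb \x mu) measurable_undergraph)
    (fst : measurableTypeR R * R -> R) measurable_fst.

Definition tail (x : R) : \bar R := mu `]x, +oo[%classic.

Lemma integral_tail_measureE h : measurable_fun setT h ->
  (forall x, 0 <= h x) ->
  \int[tail_measure]_x h x = \int[leb \x mu]_z ((\1_undergraph z)%:E * h z.1).
Proof.
move=> mh h0.
have mh1 : measurable_fun setT (h \o (fst : measurableTypeR R * R -> R)).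
  by apply: (measurableT_comp mh); exact: measurable_fst.
have -> : \int[tail_measure]_x h x =
    \int[mrestr (leb \x mu) measurable_undergraph]_z (h \o fst) z.
  exact: (@ge0_integral_pushforward _ _ _ _ _ (fst : measurableTypeR R * R -> R)
    measurable_fst (mrestr (leb \x mu) measurable_undergraph) setT h).
rewrite (integral_mrestr (leb \x mu) measurable_undergraph mh1);
  last by move=> z; exact: h0.
rewrite integral_mkcond epatch_indic; apply: eq_integral => z _.
by rewrite /= muleC.
Qed.

Lemma measurable_under_mul h : measurable_fun setT h ->
  measurable_fun setT (fun z : measurableTypeR R * R =>
    (\1_undergraph z)%:E * h z.1).
Proof.
move=> mh; apply: emeasurable_funM.
  by apply/measurable_EFinP; exact: measurable_indic_undergraph.
by apply: (measurableT_comp mh); exact: measurable_fst.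
Qed.

Lemma integral_tail_measure_density h : measurable_fun setT h ->
  (forall x, 0 <= h x) ->
  \int[tail_measure]_x h x = \int[leb]_(x in `[0%R, +oo[) (tail x * h x).
Proof.
move=> mh h0; rewrite integral_tail_measureE// fubini_tonelli1//; last 2 first.
- exact: measurable_under_mul.
- by move=> z; rewrite mule_ge0// lee_fin.
rewrite [RHS]integral_mkcond; apply: eq_integral => x _.
rewrite /fubini_F/= patchE; case: ifPn => [|];
  rewrite ?notin_setE ?inE /= in_itv/= andbT => x0.
  rewrite ge0_integralZr//; last first.
    apply/measurable_EFinP.
    apply: (measurableT_comp measurable_indic_undergraph).
    exact: measurable_pair1.
  congr (_ * _).
  rewrite (_ : (fun y : R => (\1_undergraph (x, y))%:E) =
    (fun y : R => (\1_(`]x, +oo[%classic : set R) y)%:E)); last first.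
    apply/funext => y; rewrite !indicE; congr ((_ : bool)%:R%:E).
    by apply/idP/idP; rewrite !inE /undergraph/= in_itv/= andbT x0.
  by rewrite integral_indic// setIT.
apply: integral0_eq => y _.
by rewrite indicE memNset ?mul0e// /undergraph/= => /andP[].
Qed.

Lemma integral_tail_measure_layer h : measurable_fun setT h ->
  (forall x, 0 <= h x) ->
  \int[tail_measure]_x h x = \int[mu]_y \int[leb]_(x in `[0%R, y[) h x.
Proof.
move=> mh h0; rewrite integral_tail_measureE// fubini_tonelli2//; last 2 first.
- exact: measurable_under_mul.
- by move=> z; rewrite mule_ge0// lee_fin.
apply: eq_integral => y _.
rewrite [RHS]integral_mkcond epatch_indic; apply: eq_integral => x _.
by rewrite /= muleC.
Qed.

Section invariance.
Hypothesis mu_ge0 : mu `]-oo, 0%R[%classic = 0.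

Lemma ae_mu_ge0 : {ae mu, forall y : R, (0 <= y)%R}.
Proof.
exists `]-oo, 0%R[%classic; split => //.
by move=> y /= /negP; rewrite -ltNge in_itv.
Qed.

Lemma ge0_eq_integral_mu h1 h2 : measurable_fun setT h1 ->
  measurable_fun setT h2 ->
  (forall x, 0 <= h1 x) -> (forall x, 0 <= h2 x) ->
  (forall x, (0 <= x)%R -> h1 x = h2 x) ->
  \int[mu]_x h1 x = \int[mu]_x h2 x.
Proof.
move=> m1 m2 h10 h20 h12; apply: ge0_ae_eq_integral => //.
by apply: filterS ae_mu_ge0 => y y0 _; exact: h12.
Qed.

Lemma measurable_landing h : measurable_fun setT h -> (forall x, 0 <= h x) ->
  measurable_fun setT (fun z : R * R => landing h z.1 z.2).
Proof.
move=> mh h0.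
pose f (z : (R * R) * measurableTypeR R) : \bar R :=
  (\1_(undergraph) (z.2, z.1.1))%:E * h `|z.2 - z.1.2|%R.
have mf : measurable_fun setT f.
  apply: emeasurable_funM.
    apply/measurable_EFinP.
    apply: (measurableT_comp measurable_indic_undergraph).
    apply/measurable_fun_pairP; split => /=.
      exact: measurable_snd.
    exact: (measurableT_comp measurable_fst measurable_fst).
  apply: (measurableT_comp mh); apply: measurableT_comp => //.
  apply: measurable_funB; first exact: measurable_snd.
  by apply: (measurableT_comp measurable_snd); exact: measurable_fst.
have f0 z : 0 <= f z by rewrite mule_ge0// lee_fin.
have := measurable_fun_fubini_tonelli_F (m2 := leb) f mf f0.
congr measurable_fun; apply/funext => -[a b]; rewrite /fubini_F/= /landing.
rewrite [RHS]integral_mkcond epatch_indic; apply: eq_integral => x _.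
by rewrite /f /= muleC.
Qed.

Lemma measurable_landing1 h a : measurable_fun setT h -> (forall x, 0 <= h x) ->
  measurable_fun setT (fun b : R => landing h a b).
Proof.
move=> mh h0; have mH := measurable_landing mh h0.
exact: (measurableT_comp mH (measurable_pair1 a)).
Qed.

Lemma measurable_landing2 h b : measurable_fun setT h -> (forall x, 0 <= h x) ->
  measurable_fun setT (fun a : R => landing h a b).
Proof.
move=> mh h0; have mH := measurable_landing mh h0.
exact: (measurableT_comp mH (measurable_pair2 b)).
Qed.

(** Writing the tail measure as the [mu]-mixture over [a] of Lebesgue measure
    on [[0, a[], the integral of [step_op h] becomes the double integral of
    [landing h a b] under [mu (x) mu]. Exchanging the two independent variables
    and using [landing_sym] shows that twice this double integral is twice the
    integral of [h]. *)
Theorem tail_measure_invariant h : measurable_fun setT h ->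
  (forall x, 0 <= h x) ->
  \int[tail_measure]_x step_op mu h x = \int[tail_measure]_x h x.
Proof.
move=> mh h0.
have mH := measurable_landing mh h0.
have H0 z : 0 <= landing h z.1 z.2 by apply: integral_ge0.
pose G a := \int[leb]_(x in `[0%R, a[) h x.
have G0 a : 0 <= G a by apply: integral_ge0.
have GE a : G a = landing h a 0.
  apply: eq_integral => x; rewrite inE /= in_itv/= => /andP[x0 _].
  by rewrite subr0 ger0_norm.
have mG : measurable_fun setT (G : R -> \bar R).
  rewrite (_ : G = (fun a => landing h a 0)); last by apply/funext => a;
    exact: GE.
  exact: measurable_landing2.
have mH1 a : measurable_fun setT (fun b : R => landing h a b).
  exact: measurable_landing1.
have mH2 a : measurable_fun setT (fun b : R => landing h b a).
  exact: measurable_landing2.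
have H01 a b : 0 <= landing h a b by exact: (H0 (a, b)).
pose I := \int[mu]_a \int[mu]_b landing h a b.
have e1 : \int[tail_measure]_x step_op mu h x = I.
  rewrite integral_tail_measure_layer//; last 2 first.
    exact: measurable_step_op.
    by move=> x; exact: step_op_ge0.
  apply: eq_integral => a _.
  pose f (z : measurableTypeR R * R) : \bar R :=
    (\1_(`[0%R, a[%classic : set R) z.1)%:E * h `|z.1 - z.2|%R.
  have mf : measurable_fun setT f.
    apply: emeasurable_funM; last exact: measurable_dist_pair.
    apply/measurable_EFinP.
    have mi : measurable_fun setT (\1_(`[0%R, a[%classic : set R) :
      measurableTypeR R -> R).
      exact: measurable_indic.
    exact: (measurableT_comp mi measurable_fst).
  have f0 z : 0 <= f z by rewrite mule_ge0// lee_fin.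
  transitivity (\int[leb]_x \int[mu]_b f (x, b)).
    rewrite integral_mkcond epatch_indic; apply: eq_integral => x _.
    by rewrite /= muleC /f /= ge0_integralZl//; exact: measurable_step.
  rewrite fubini_tonelli//; apply: eq_integral => b _.
  rewrite [RHS]integral_mkcond epatch_indic; apply: eq_integral => x _.
  by rewrite /f /= muleC.
pose F a := \int[mu]_b landing h a b.
pose F' a := \int[mu]_b landing h b a.
have F0 a : 0 <= F a by exact: integral_ge0.
have F'0 a : 0 <= F' a by exact: integral_ge0.
have mF : measurable_fun setT F.
  exact: (measurable_fun_fubini_tonelli_F (m2 := mu)
    (fun z : R * R => landing h z.1 z.2) mH H0).
have mF' : measurable_fun setT F'.
  exact: (measurable_fun_fubini_tonelli_G (m1 := mu)
    (fun z : R * R => landing h z.1 z.2) mH H0).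
have e2 : I = \int[mu]_b F' b.
  exact: (fubini_tonelli (m1 := mu) (m2 := mu)
    (fun z : R * R => landing h z.1 z.2) mH H0).
have iG : \int[mu]_a G a = \int[tail_measure]_x h x
  by rewrite integral_tail_measure_layer.
(* exchange a and b in one of the two copies *)
have e3 : I + I = \int[tail_measure]_x h x + \int[tail_measure]_x h x.
  transitivity (\int[mu]_a (F a + F' a)).
    rewrite (ge0_integralD mu measurableT (fun a _ => F0 a) mF
      (fun a _ => F'0 a) mF').
    exact: (f_equal (fun u => I + u) e2).
  transitivity (\int[mu]_a (G a + \int[mu]_b G b)); last first.
    have k0 : 0 <= \int[mu]_b G b by exact: integral_ge0.
    rewrite (integralDcst mu mG G0 k0);
      exact: (f_equal2 (fun u v => u + v) iG iG).
  have k0 : 0 <= \int[mu]_b G b by exact: integral_ge0.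
  apply: (ge0_eq_integral_mu (emeasurable_funD mF mF')
    (emeasurable_funD mG (measurable_cst _))
    (fun a => adde_ge0 (F0 a) (F'0 a)) (fun a => adde_ge0 (G0 a) k0)).
  move=> a a0; transitivity (\int[mu]_b (landing h a b + landing h b a)).
    rewrite (ge0_integralD mu measurableT (fun b _ => H01 a b) (mH1 a)
      (fun b _ => H01 b a) (mH2 a)).
    exact: erefl.
  transitivity (\int[mu]_b (G b + G a)); last first.
    by rewrite (integralDcst mu mG G0 (G0 a)) addeC.
  apply: (ge0_eq_integral_mu (emeasurable_funD (mH1 a) (mH2 a))
    (emeasurable_funD mG (measurable_cst _))
    (fun b => adde_ge0 (H01 a b) (H01 b a)) (fun b => adde_ge0 (G0 b) (G0 a))).
  by move=> b b0; rewrite [RHS]addeC; exact: landing_sym.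
have I0 : 0 <= I by apply: integral_ge0 => a _; apply: integral_ge0.
have N0 : 0 <= \int[tail_measure]_x h x by exact: integral_ge0.
rewrite e1; exact: adde_self_inj.
Qed.

End invariance.
End tail_measure_theory.

(** * The flux argument: almost every point of a bounded set returns to it *)

Section flux.
Context (R : realType) (mu : probability R R).
Local Notation leb := (@lebesgue_measure R).
Implicit Types (h : R -> \bar R) (x y : R).
Hypothesis mu_ge0 : mu `]-oo, 0%R[%classic = 0.

Lemma tail_ge0 x : 0 <= tail mu x. Proof. exact: measure_ge0. Qed.

Lemma tail_le1 x : tail mu x <= 1.
Proof. by apply: probability_le1. Qed.

Lemma tail_nonincreasing x y : (x <= y)%R -> tail mu y <= tail mu x.
Proof.
move=> xy; apply: le_measure; rewrite ?inE//.
by apply: subset_itvr; rewrite bnd_simp.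
Qed.

Let id_mixin := isMeasurableFun.Build _ _ R R idfun (@measurable_id _ R setT).
Let id_RV : {mfun R >-> R} := HB.pack (idfun : R -> R) id_mixin.

Lemma tailE : tail mu = ccdf (P := mu) id_RV.
Proof. by apply/funext => x. Qed.

Lemma measurable_tail : measurable_fun setT (tail mu).
Proof. by rewrite tailE; exact: ccdf_measurable. Qed.

Lemma tail_cvg0 : tail mu n%:R @[n --> \oo] --> 0.
Proof. by rewrite tailE; apply: (cvg_comp _ _ (@cvgr_idn R));
  exact: cvg_ccdfy0. Qed.

Definition below (M : R) : set R := `]-oo, M]%classic.

Lemma measurable_below M : measurable (below M).
Proof. exact: measurable_itv. Qed.

Lemma measurable_EFin_indic (A : set R) : measurable A ->
  measurable_fun setT (fun x : R => (\1_A x : R)%:E).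
Proof. by move=> mA; apply/measurable_EFinP; exact: measurable_indic. Qed.

Lemma EFin_indic_ge0 (A : set R) x : 0 <= (\1_A x : R)%:E.
Proof. by rewrite lee_fin. Qed.

Lemma tail_measure_densityE (A : set R) : measurable A ->
  tail_measure mu A = \int[leb]_(x in `[0%R, +oo[) (tail mu x * (\1_A x)%:E).
Proof.
move=> mA; rewrite -(integral_tail_measure_density mu
  (measurable_EFin_indic mA) (@EFin_indic_ge0 A)).
by rewrite (integral_indic (tail_measure mu) measurableT mA) setIT.
Qed.

Lemma tail_measure_below_lty (M : R) : tail_measure mu (below M) < +oo.
Proof.
have mM := @measurable_below M.
rewrite (tail_measure_densityE mM).
apply: (@le_lt_trans _ _ (\int[leb]_(x in `[0%R, +oo[) (\1_(below M) x)%:E)).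
  apply: ge0_le_integral => //.
  - by move=> x _; rewrite mule_ge0 ?tail_ge0// EFin_indic_ge0.
  - apply: measurable_funTS; apply: emeasurable_funM;
      first exact: measurable_tail.
    exact: measurable_EFin_indic.
  - by apply: measurable_funTS; exact: measurable_EFin_indic.
  - move=> x _; rewrite -[leRHS]mul1e; apply: lee_wpmul2r;
      first exact: EFin_indic_ge0.
    exact: tail_le1.
rewrite (integral_indic leb _ mM)//.
rewrite (_ : _ `&` _ = `[0%R, M]%classic).
  have L : lebesgue_measure (`[0%R, M]%classic : set R) < +oo.
    by rewrite lebesgue_measure_itv/=; case: ifP => _; rewrite -?EFinB ltry.
  exact: L.
apply/seteqP; split => x /=; rewrite /below /= !in_itv/= ?andbT.
  by move=> [-> ->].
by move=> /andP[-> ->].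
Qed.

(** The mass that jumps in one step from [[0, M]] to a point above [M]; such a
    jump is necessarily a reflection. *)
Definition overshoot (M : R) :=
  \int[tail_measure mu]_x ((\1_(below M) x)%:E * step_op mu
    (fun z => (\1_(~` below M) z)%:E) x).

Lemma measurable_step_op_indic (A : set R) : measurable A ->
  measurable_fun setT (step_op mu (fun z => (\1_A z)%:E)).
Proof.
by move=> mA; apply: measurable_step_op;
  [exact: measurable_EFin_indic|exact: EFin_indic_ge0].
Qed.

(** From [0 <= x <= M] the walk gets above [M] only with an increment above
    [M]. *)
Lemma step_op_above_le (x M : R) : (0 <= x)%R ->
  (\1_(below M) x)%:E * step_op mu (fun z => (\1_(~` below M) z)%:E) x
    <= tail mu M.
Proof.
move=> x0; have mM : measurable (~` below M) by apply: measurableC;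
  exact: measurable_below.
rewrite indicE; case: (boolP (x \in _)) => /= [|_];
  last by rewrite mul0e tail_ge0.
rewrite mul1e inE /below /= in_itv/= => xM.
rewrite (step_op_indic mu x mM).
have mU : measurable ([set` `]M, +oo[] `|` [set` `]-oo, 0%R[] : set R).
  by apply: measurableU.
apply: (@le_trans _ _ (mu ([set` `]M, +oo[] `|` [set` `]-oo, 0%R[]))).
  apply: le_measure; rewrite ?inE//.
    rewrite -[X in measurable X]setTI.
    have mN : measurable_fun setT (fun y : R => `|x - y|%R).
      by apply: measurableT_comp => //; apply: measurable_funB.
    exact: mN.
  move=> y /=; rewrite /below /= !in_itv/= andbT => /negP; rewrite -ltNge => h.
  have [y0|y0] := ltP y 0%R; [by right|left].
  move: h; rewrite ltr_normr => /orP[|]; lra.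
apply: le_trans (measureU2 _ _ _) _ => //.
rewrite -[leRHS]adde0; apply: leeD; first exact: lexx.
by rewrite le_eqVlt; apply/orP; left; apply/eqP; exact: mu_ge0.
Qed.

(** The integrand is at most [tail x * tail M], hence at most the square of the
    tail where it does not vanish: this is where the integrability of the
    squared tail enters, through dominated convergence. *)
Lemma overshoot_cvg0 :
  \int[leb]_(x in `[0%R, +oo[) (tail mu x * tail mu x) < +oo ->
  overshoot n%:R @[n --> \oo] --> 0.
Proof.
move=> tsq.
pose g n x := (\1_(below n%:R) x)%:E * step_op mu
  (fun z => (\1_(~` below n%:R) z)%:E) x.
have mg n : measurable_fun setT (g n).
  apply: emeasurable_funM; first by apply: measurable_EFin_indic;
    exact: measurable_below.
  by apply: measurable_step_op_indic; apply: measurableC;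
    exact: measurable_below.
have g0 n x : 0 <= g n x.
  rewrite mule_ge0 ?EFin_indic_ge0//; apply: step_op_ge0 => z;
    exact: EFin_indic_ge0.
pose f n x := tail mu x * g n x.
have mf n : measurable_fun setT (f n).
  by apply: emeasurable_funM; [exact: measurable_tail|exact: mg].
have f0 n x : 0 <= f n x by rewrite mule_ge0// tail_ge0.
have mt2 : measurable_fun setT (fun x => tail mu x * tail mu x).
  by apply: emeasurable_funM; exact: measurable_tail.
have oE n : overshoot n%:R = \int[leb]_(x in `[0%R, +oo[) f n x.
  exact: (integral_tail_measure_density mu (mg n) (g0 n)).
have fle n x : (0 <= x)%R -> f n x <= tail mu n%:R.
  move=> x0; rewrite -[leRHS]mul1e; apply: lee_pmul; rewrite ?tail_ge0//.
    exact: tail_le1.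
  exact: step_op_above_le.
have fle2 n x : (0 <= x)%R -> f n x <= tail mu x * tail mu x.
  move=> x0; apply: lee_wpmul2l; first exact: tail_ge0.
  have [xn|nx] := leP x n%:R.
    by apply: le_trans (step_op_above_le _ x0) _; exact: tail_nonincreasing.
  rewrite /g indicE memNset ?mul0e ?tail_ge0//.
  by rewrite /below /= in_itv/= => /(lt_le_trans nx); rewrite ltxx.
rewrite (_ : (fun n => overshoot n%:R) =
  (fun n => \int[leb]_(x in `[0%R, +oo[) f n x)); last first.
  by apply/funext.
have [] := @dominated_convergence _ _ _ leb `[0%R, +oo[%classic _ f (cst 0)
  (fun x => tail mu x * tail mu x).
- by [].
- by move=> n; exact: (measurable_funTS (mf n)).
- exact: measurable_cst.
- apply: aeW => x /=; rewrite in_itv/= andbT => x0.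
  apply: (@squeeze_cvge _ _ _ _ (cst 0) _ (fun n => tail mu n%:R)).
  + by apply: nearW => n; rewrite f0/= fle.
  + exact: cvg_cst.
  + exact: tail_cvg0.
- apply/integrableP; split; first exact: measurable_funTS.
  under eq_integral do rewrite gee0_abs ?mule_ge0 ?tail_ge0//.
  exact: tsq.
- by apply: aeW => x n /=; rewrite in_itv/= andbT => x0;
    rewrite gee0_abs// fle2.
by move=> _ _; rewrite integral0.
Qed.

Lemma tail_measure_itv_gt0 (u w : R) : (0 <= u < w)%R -> 0 < tail mu w ->
  0 < tail_measure mu `]u, w[%classic.
Proof.
move=> /andP[u0 uw] tw.
rewrite tail_measure_densityE//.
apply: (@lt_le_trans _ _ (\int[leb]_(x in
  `[0%R, +oo[) (tail mu w * (\1_(`]u, w[%classic : set R) x)%:E))).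
  have mI : measurable_fun (`[0%R, +oo[%classic : set (measurableTypeR R))
    (fun x => (\1_(`]u, w[%classic : set R) x : R)%:E).
    by apply: measurable_funTS; exact: measurable_EFin_indic.
  rewrite (@ge0_integralZl _ _ _ leb _ (measurable_itv _) _ mI (tail mu w)
    (fun x _ => EFin_indic_ge0 _ x) (tail_ge0 w)).
  rewrite (integral_indic leb)//.
  rewrite (_ : _ `&` _ = `]u, w[%classic).
    have L : 0 < lebesgue_measure (`]u, w[%classic : set R).
      by rewrite lebesgue_measure_itv/= lte_fin uw -EFinB lte_fin subr_gt0.
    exact: mule_gt0 tw L.
  apply/seteqP; split => x /=; rewrite !in_itv/= ?andbT; first by case.
  by move=> /andP[ux ->]; rewrite ux; split => //; lra.
apply: ge0_le_integral => //.
- by move=> x _; rewrite mule_ge0 ?tail_ge0// EFin_indic_ge0.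
- by apply: measurable_funTS; apply: emeasurable_funM;
    [exact: measurable_cst|exact: measurable_EFin_indic].
- by apply: measurable_funTS; apply: emeasurable_funM;
    [exact: measurable_tail|exact: measurable_EFin_indic].
- move=> x _; rewrite indicE; case: (boolP (x \in _)) => /= [|_];
    last by rewrite !mule0.
  rewrite !mule1 inE/= in_itv/= => /andP[_ xw].
  by apply: tail_nonincreasing; exact: ltW.
Qed.

Variable c : R.

Let a := never mu (below c).
Let ma : measurable_fun setT a.
Proof. by apply: measurable_never; exact: measurable_below. Qed.
Let a0 x : 0 <= a x.
Proof. by apply: never_ge0; exact: measurable_below. Qed.
Let mQa : measurable_fun setT (step_op mu a).
Proof. exact: measurable_step_op. Qed.
Let Qa0 x : 0 <= step_op mu a x.
Proof. exact: step_op_ge0. Qed.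

Let mI (A : set R) : measurable A ->
  measurable_fun setT (fun x : R => (\1_A x : R)%:E).
Proof. exact: measurable_EFin_indic. Qed.

(** Let [a] be the probability never to visit [[0, c]]. Stationarity on
    [[0, M]] compares the integral of [step_op a] over [[0, M]] with the one of
    [a], which differs from [step_op a] only on [[0, c]]: the mass that leaves
    [[0, c]] for ever is at most the mass that crosses [M]. *)
Lemma flux_le M : (c <= M)%R ->
  \int[tail_measure mu]_x ((\1_(below c) x)%:E * step_op mu
    (never mu (below c)) x)
  <= overshoot M.
Proof.
move=> cM; rewrite -/a.
pose iM x : \bar R := (\1_(below M) x)%:E.
pose jM x : \bar R := (\1_(~` below M) x)%:E.
pose ic x : \bar R := (\1_(below c) x)%:E.
have miM : measurable_fun setT iM by apply: mI; exact: measurable_below.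
have mjM : measurable_fun setT jM.
  by apply: mI; apply: measurableC; exact: measurable_below.
have mic : measurable_fun setT ic by apply: mI; exact: measurable_below.
have iM0 x : 0 <= iM x by exact: EFin_indic_ge0.
have jM0 x : 0 <= jM x by exact: EFin_indic_ge0.
have ic0 x : 0 <= ic x by exact: EFin_indic_ge0.
have iMa0 x : 0 <= iM x * a x by exact: mule_ge0.
have miMa : measurable_fun setT (fun x => iM x * a x)
  by exact: emeasurable_funM.
pose K := \int[tail_measure mu]_x (iM x * a x).
have Kfin : K \is a fin_num.
  rewrite ge0_fin_numE; last exact: integral_ge0.
  apply: le_lt_trans (tail_measure_below_lty M).
  apply: (@le_trans _ _ (\int[tail_measure mu]_x iM x)).
    apply: ge0_le_integral => // x _; rewrite -[leRHS]mule1;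
      apply: lee_wpmul2l => //.
    by apply: never_le1; exact: measurable_below.
  by rewrite (integral_indic (tail_measure mu) measurableT
    (@measurable_below M)) setIT.
(* step_op a and a agree outside [0, c], and a vanishes on [0, c] *)
have e1 : \int[tail_measure mu]_x (iM x * step_op mu a x) =
    \int[tail_measure mu]_x (ic x * step_op mu a x) + K.
  rewrite -(ge0_integralD (tail_measure mu) measurableT
    (fun x _ => mule_ge0 (ic0 x) (Qa0 x)) (emeasurable_funM mic mQa)
    (fun x _ => iMa0 x) miMa).
  apply: eq_integral => x _.
  rewrite /a neverE; last exact: measurable_below.
  rewrite /iM /ic !indicE in_setC; case: (boolP (x \in below c)) => /= xc.
    have -> : x \in below M.
      by move: xc; rewrite !inE /below /= !in_itv/= => /le_trans; exact.
    by rewrite mul0e mule0 adde0.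
  by rewrite !mul0e add0e mul1e.
(* stationarity, after splitting a at the level M *)
have e2 : \int[tail_measure mu]_x (iM x * step_op mu a x) <= K + overshoot M.
  have q0 x : 0 <= step_op mu (fun z => iM z * a z) x by exact: step_op_ge0.
  have mq : measurable_fun setT (step_op mu (fun z => iM z * a z))
    by exact: measurable_step_op.
  have p0 x : 0 <= step_op mu jM x by exact: step_op_ge0.
  have mp : measurable_fun setT (step_op mu jM) by exact: measurable_step_op.
  apply: (@le_trans _ _ (\int[tail_measure mu]_x
    (step_op mu (fun z => iM z * a z) x + iM x * step_op mu jM x))).
    have mL := emeasurable_funM miM mQa.
    have mR := emeasurable_funD mq (emeasurable_funM miM mp).
    apply: (@ge0_le_integral _ _ _ (tail_measure mu) setT measurableT _ _ _ mL
      mR).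
      by move=> x _; exact: mule_ge0.
    move=> x _.
    have Qle : step_op mu a x <= step_op mu (fun z => iM z * a z) x +
      step_op mu jM x.
      rewrite -step_opD//; apply: le_step_op => //;
        first exact: emeasurable_funD.
      move=> z _; rewrite /iM /jM !indicE in_setC; case: (z \in _) => /=.
        by rewrite mul1e adde0.
      by rewrite mul0e add0e; apply: never_le1; exact: measurable_below.
    have [->|->] : iM x = 1 \/ iM x = 0.
        by rewrite /iM indicE; case: (x \in _); [left|right].
      by rewrite !mul1e.
    by rewrite !mul0e adde0.
  rewrite (ge0_integralD (tail_measure mu) measurableT (fun x _ => q0 x) mq
    (fun x _ => mule_ge0 (iM0 x) (p0 x)) (emeasurable_funM miM mp)).
  by rewrite (tail_measure_invariant mu_ge0 miMa iMa0).
by move: e2; rewrite e1 addeC leeD2lE.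
Qed.

Hypothesis tail_c : 0 < tail mu c.
Hypothesis tail_sq : \int[leb]_(x in `[0%R, +oo[) (tail mu x * tail mu x) < +oo.

Lemma flux_eq0 :
  \int[tail_measure mu]_x ((\1_(below c) x)%:E * step_op mu
    (never mu (below c)) x) = 0.
Proof.
apply/eqP; rewrite eq_le; apply/andP; split; last first.
  by apply: integral_ge0 => x _; rewrite mule_ge0// EFin_indic_ge0.
rewrite -(cvg_lim _ (overshoot_cvg0 tail_sq))//.
apply: lime_ge; first by apply/cvg_ex; exists 0; exact: overshoot_cvg0.
near=> n; apply: flux_le; near: n; exact: nbhs_infty_ger.
Unshelve. all: by end_near. Qed.

(** Since the flux vanishes, almost every point of [[0, c]] returns to [[0, c]]
    almost surely; the tail measure charges every interval in [[0, c]], so such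
    points are dense. *)
Lemma return_dense (u w : R) : (0 <= u < w)%R -> (w <= c)%R ->
  exists2 p, (u < p < w)%R & step_op mu (never mu (below c)) p = 0.
Proof.
move=> uw wc.
have mF : measurable_fun setT (fun x => (\1_(below c) x)%:E * step_op mu a x).
  by apply: emeasurable_funM => //; apply: mI; exact: measurable_below.
have F0 : \int[tail_measure mu]_x `|(\1_(below c) x)%:E * step_op mu a x| = 0.
  rewrite -[RHS]flux_eq0; apply: eq_integral => x _.
  by rewrite gee0_abs// mule_ge0// EFin_indic_ge0.
have [N [mN N0 sN]] := (ae_eq_integral_abs (tail_measure mu) measurableT mF).1
  F0.
have [[p [pI pN]]|nex] := pselect (exists p, `]u, w[%classic p /\ ~ N p).
  exists p; first by move: pI; rewrite /= in_itv.
  apply: contrapT => Qp; apply: pN; apply: sN => /= /(_ Logic.I).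
  move: pI; rewrite /= in_itv/= => /andP[up pw].
  by rewrite indicE mem_set ?mul1e// /below /= in_itv/=; lra.
have : tail_measure mu `]u, w[%classic <= tail_measure mu N.
  apply: le_measure; rewrite ?inE// => p pI.
  by apply: contrapT => pN; apply: nex; exists p.
rewrite N0 leNgt tail_measure_itv_gt0//.
by apply: lt_le_trans tail_c _; exact: tail_nonincreasing.
Qed.

End flux.

(** * From return to bounded sets to visits of a given set *)

Section recurrence.
Context (R : realType) (mu : probability R R).
Local Notation leb := (@lebesgue_measure R).
Implicit Types (h : R -> \bar R) (x y z : R) (V W : set R).
Hypothesis mu_ge0 : mu `]-oo, 0%R[%classic = 0.

(** Within a bounded time, and with a probability bounded below on a
    neighbourhood of [z], the walk visits [W]. *)
Definition locally_hits W z := exists n (eps : R),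
  (0 < eps)%R /\ \forall z' \near z, avoid mu W n z' <= (1 - eps)%:E.

Lemma locally_hits_in W z : open W -> W z -> locally_hits W z.
Proof.
move=> oW Wz; exists 1%N, 1%R; split => //.
have nW : nbhs z W by apply: open_nbhs_nbhs.
apply: filterS nW => z' Wz'; by rewrite avoid_in// subrr.
Qed.

(** If one increment [y] of the support moves [z] to a point that hits [W],
    then so do the increments in a small ball around [y], which has positive
    probability, from all points near [z]. *)
Lemma locally_hits_step W z y : measurable W -> supp mu y ->
  locally_hits W `|z - y|%R -> locally_hits W z.
Proof.
move=> mW sy [n [eps [eps0 /nbhs_ballP [r /= r0 Hr]]]].
pose B : set R := ball y (r / 2)%R.
have r20 : (0 < r / 2)%R by lra.
have mB : measurable B by apply: open_measurable; exact: ball_open.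
have pB : 0 < mu B by apply: sy; [exact: ball_open|exact: ballxx].
have pBfin : mu B \is a fin_num by exact: fin_num_measure.
have muB : mu B = (fine (mu B))%:E by rewrite fineK.
exists n.+1, (eps * fine (mu B))%R; split.
  by rewrite mulr_gt0// -lte_fin -muB.
apply/nbhs_ballP; exists (r / 2)%R => //= z' zz'.
apply: (@le_trans _ _ (step_op mu (avoid mu W n) z')).
  by apply: indic_mule_le; apply: step_op_ge0 => ?; exact: avoid_ge0.
rewrite EFinB leeBrDr// EFinM -muB.
have mA : measurable_fun setT (fun y' : R => avoid mu W n `|z' - y'|%R).
  by apply: measurable_step; exact: measurable_avoid.
have mIB : measurable_fun setT (fun y' : R => (\1_B y' : R)%:E).
  exact: measurable_EFin_indic.
have e : eps%:E * mu B = \int[mu]_y' (eps%:E * (\1_B y')%:E).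
  rewrite (@ge0_integralZl _ _ _ mu _ measurableT _ mIB eps%:E
    (fun x _ => EFin_indic_ge0 _ x)); last by rewrite lee_fin ltW.
  by rewrite (integral_indic mu measurableT mB) setIT.
have e0 : 0 <= eps%:E by rewrite lee_fin ltW.
have mE : measurable_fun setT (fun y' : R => eps%:E * (\1_B y' : R)%:E).
  by apply: emeasurable_funM.
rewrite e -(ge0_integralD mu measurableT (fun x _ => avoid_ge0 _ _ _ _) mA
  (fun x _ => mule_ge0 e0 (EFin_indic_ge0 _ x)) mE).
rewrite -[leRHS](step_op_cst mu 1 z') /step_op.
apply: ge0_le_integral => //.
- by move=> y' _; rewrite adde_ge0 ?avoid_ge0// mule_ge0// EFin_indic_ge0.
- exact: emeasurable_funD.
move=> y' _; rewrite indicE; case: (boolP (_ \in _)) => /=; last first.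
  by rewrite mule0 adde0 => _; exact: avoid_le1.
rewrite inE mule1 => By'.
rewrite -leeBrDr// -EFinB; apply: Hr.
rewrite /ball /=; apply: le_lt_trans (ler_dist_dist _ _) _.
move: zz' By'; rewrite /B /ball /= => h1 h2.
rewrite (_ : z - y - (z' - y') = (z - z') - (y - y'))%R; last by ring.
by apply: le_lt_trans (ler_normB _ _) _; lra.
Qed.

(** Compactness of [[0, beta]]; the bounds improve with time since [avoid] is
    nonincreasing, so a common time and probability can be chosen. *)
Lemma uniformly_hits W (beta : R) : measurable W ->
  (forall z, (0 <= z)%R -> locally_hits W z) ->
  exists n (eps : R), (0 < eps)%R /\
    forall z, (0 <= z <= beta)%R -> avoid mu W n z <= (1 - eps)%:E.
Proof.
move=> mW gW.
have cK : compact (`[0%R, beta]%classic : set R) by exact: segment_compact.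
have := (compact_near_coveringP _).1 cK nat \oo
  (fun k z => avoid mu W k z <= (1 - k.+1%:R^-1)%:E) _ _.
case.
  move=> z; rewrite /= in_itv/= => /andP[z0 _].
  have [n [eps [eps0 Hn]]] := gW z z0.
  have H2 : \forall k \near \oo, (n <= k)%N /\ (k.+1%:R^-1 <= eps)%R.
    near=> k; split; first by near: k; exact: nbhs_infty_ge.
    by apply: ltW; near: k; exact: near_infty_natSinv_lt (PosNum eps0).
  exists ([set z' | avoid mu W n z' <= (1 - eps)%:E],
    [set k | (n <= k)%N /\ (k.+1%:R^-1 <= eps)%R]) => //.
  move=> [z' k] /= [h1 [h2 h3]].
  apply: le_trans (avoid_antimono mu mW z' h2) _.
  by apply: le_trans h1 _; rewrite lee_fin lerD2l lerN2.
move=> n _ /(_ n (leqnn n)) H; exists n, n.+1%:R^-1%R; split;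
  first by rewrite invr_gt0.
by move=> z zb; apply: H; rewrite /= in_itv.
Unshelve. all: by end_near. Qed.

Section confined.
Variables (beta : R).
Let V : set R := `]-oo, beta[%classic.
Let mV : measurable V. Proof. exact: measurable_itv. Qed.
Hypothesis QV0 : forall z, (0 <= z < beta)%R -> step_op mu (never mu V) z = 0.

(** If every point of [[0, beta[] returns to it almost surely, the probability
    never to visit it is preserved by the transition operator, also at the
    points of [[0, beta[], where both sides vanish. *)
Lemma never_harmonic z : (0 <= z)%R -> step_op mu (never mu V) z = never mu V z.
Proof.
move=> z0; rewrite [RHS]neverE// indicE in_setC.
case: (boolP (z \in V)) => /=; last by rewrite mul1e.
by rewrite mul0e inE /V/= in_itv/= => zb; rewrite QV0// z0.
Qed.

Variables (W : set R) (mW : measurable W) (n0 : nat) (eps : R).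
Hypothesis eps0 : (0 < eps)%R.
Hypothesis hitW : forall z, (0 <= z < beta)%R ->
  avoid mu W n0 z <= (1 - eps)%:E.

(** Let [s] be the supremum over [[0, beta[] of the probability never to visit
    [W]. A walk that visits [[0, beta[] avoids [W] afterwards with probability
    at most [s]; a walk started in [[0, beta[] returns there after time [n0],
    and it avoided [W] before with probability at most [1 - eps]. Hence
    [s <= s * (1 - eps)], so [s = 0]. *)
Lemma never_confined z : (0 <= z < beta)%R -> never mu W z = 0.
Proof.
move=> zb.
pose S := [set never mu W u | u in [set u : R | (0 <= u < beta)%R]].
pose s := ereal_sup S.
have sub u : (0 <= u < beta)%R -> never mu W u <= s.
  by move=> ub; apply: ereal_sup_ubound; exists u.
have s0 : 0 <= s by apply: le_trans (sub _ zb); exact: never_ge0.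
have s1 : s <= 1 by apply: ge_ereal_sup => _ [u _ <-]; exact: never_le1.
have mbW := measurable_never mu mW.
have bW0 u : 0 <= never mu W u by exact: never_ge0.
have bWQ u : never mu W u <= step_op mu (never mu W) u.
  by rewrite [leLHS]neverE//; apply: indic_mule_le; exact: step_op_ge0.
have mcst : measurable_fun setT (cst s : R -> \bar R) by exact: measurable_cst.
(* stop the walk at its first visit to V, where the bound s applies *)
have S1 n u : (0 <= u)%R -> never mu W u <= s + avoid mu V n u.
  elim: n u => [|n IH] u u0.
    by apply: le_trans (never_le1 mu mW u) _; rewrite leeDr.
  have [ub|bu] := ltP u beta.
    by apply: (@le_trans _ _ s);
      [apply: sub; rewrite u0|rewrite leeDl// avoid_ge0].
  apply: le_trans (bWQ u) _.
  apply: (@le_trans _ _ (step_op mu (fun v => s + avoid mu V n v) u)).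
    apply: le_step_op => //; apply: (emeasurable_funD mcst);
      exact: measurable_avoid.
  rewrite (step_opD mu u mcst (measurable_avoid mu mV n) (fun=> s0)
    (avoid_ge0 mu V n)) step_op_cst.
  by rewrite leeD2l// [leRHS]/= indicE mem_set ?mul1e// /V/= in_itv/=;
    apply/negP; rewrite -leNgt.
have S1' u : (0 <= u)%R -> never mu W u <= s + never mu V u.
  move=> u0; have cv : s + avoid mu V n u @[n --> \oo] --> s + never mu V u.
    apply: cvgeD; [|exact: cvg_cst|exact: cvg_avoid].
    by apply: ge0_adde_def; rewrite inE// never_ge0.
  rewrite -(cvg_lim _ cv)//; apply: lime_ge; first by apply/cvg_ex; eexists;
    exact: cv.
  by apply: nearW => n; exact: S1.
(* run the walk for n steps first; never_harmonic keeps the second term *)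
have S2 n u : (0 <= u)%R -> never mu W u <= s * avoid mu W n u + never mu V u.
  elim: n u => [|n IH] u u0; first by rewrite mule1; exact: S1'.
  rewrite [leLHS]neverE// indicE in_setC.
  case: (boolP (u \in W)) => /= uW.
    by rewrite mul0e adde_ge0 ?never_ge0// mule_ge0// mule_ge0// ?lee_fin//;
      apply: step_op_ge0 => ?; exact: avoid_ge0.
  rewrite mul1e indicE in_setC uW mul1e.
  have m1 : measurable_fun setT (fun v => s * avoid mu W n v).
    by apply: (emeasurable_funM mcst); exact: measurable_avoid.
  have p1 v : 0 <= s * avoid mu W n v by rewrite mule_ge0// avoid_ge0.
  have m2 := measurable_never mu mV.
  have p2 v : 0 <= never mu V v by exact: never_ge0.
  apply: (@le_trans _ _ (step_op mu
    (fun v => s * avoid mu W n v + never mu V v) u)).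
    by apply: le_step_op => //; exact: emeasurable_funD.
  rewrite (step_opD mu u m1 m2 p1 p2) never_harmonic//.
  by rewrite (step_opZ mu u (measurable_avoid mu mW n) (avoid_ge0 mu W n) s0).
have sle : s <= s * (1 - eps)%:E.
  apply: ge_ereal_sup => _ [u ub <-].
  have u0 : (0 <= u)%R by case/andP: ub.
  apply: le_trans (S2 n0 u u0) _.
  rewrite never_in// ?adde0; last by case/andP: ub => _; rewrite /V/= in_itv.
  by apply: lee_wpmul2l => //; exact: hitW.
have sf : s \is a fin_num by rewrite ge0_fin_numE//; apply: le_lt_trans s1 _;
  rewrite ltry.
apply/eqP; rewrite eq_le never_ge0// andbT.
apply: le_trans (sub _ zb) _.
have [t st] : exists t, s = t%:E by exists (fine s); rewrite fineK.
rewrite st -EFinM !lee_fin in sle s0 *.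
have [//|t0] := leP t 0%R.
by have := mulr_gt0 t0 eps0; move: sle; rewrite mulrBr mulr1; lra.
Qed.

End confined.

Variable c : R.
Hypothesis c_gt0 : (0 < c)%R.
Hypothesis tail_c : 0 < tail mu c.
Hypothesis tail_sq : \int[leb]_(x in `[0%R, +oo[) (tail mu x * tail mu x) < +oo.

(** A point [z] of [[0, beta[] is within distance [e] of some [p] in [[0, c]]
    that returns to [[0, c]], with [c + e < beta]; the coupled walk from [z]
    then returns to [[0, beta[]. Thus the exceptional null set disappears once
    the target interval is enlarged a little. *)
Lemma return_everywhere (beta z : R) : (c < beta)%R -> (0 <= z < beta)%R ->
  step_op mu (never mu `]-oo, beta[%classic) z = 0.
Proof.
move=> cb /andP[z0 zb].
have mc := @measurable_below R c.
have mV : measurable (`]-oo, beta[%classic : set R) by exact: measurable_itv.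
have [p [e [ce zpe Qp]]] : exists p e, [/\ (c + e < beta)%R,
    (`|z - p| <= e)%R & step_op mu (never mu (below c)) p = 0].
  have [zc|cz] := ltP z c.
    pose w := Num.min c (z + (beta - c) / 2)%R.
    have wc : (w <= c)%R by rewrite /w ge_min lexx.
    have wz : (w <= z + (beta - c) / 2)%R by rewrite /w ge_min lexx orbT.
    have zw : (z < w)%R by rewrite /w lt_min zc/=; lra.
    have [|//|p /andP[zp pw] Qp] :=
      return_dense mu_ge0 tail_c tail_sq (u := z) (w := w).
      by rewrite z0.
    exists p, ((beta - c) / 2)%R; split => //; first by lra.
    by rewrite distrC ger0_norm; lra.
  pose u := Num.max 0%R (c - (beta - z) / 2)%R.
  have u0 : (0 <= u)%R by rewrite /u le_max lexx.
  have uz : (c - (beta - z) / 2 <= u)%R by rewrite /u le_max lexx orbT.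
  have uc : (u < c)%R by rewrite /u gt_max c_gt0/=; lra.
  have [|//|p /andP[up pc] Qp] :=
    return_dense mu_ge0 tail_c tail_sq (u := u) (w := c).
    by rewrite u0.
  exists p, ((z - c) + (beta - z) / 2)%R; split => //; first by lra.
  by rewrite ger0_norm; lra.
apply/eqP; rewrite eq_le; apply/andP; split; last by apply: step_op_ge0 => ?;
  exact: never_ge0.
rewrite -Qp; apply: (@never_coupling R mu (below c) _ e mc mV _ p z zpe) => p'
  z' z'p'.
rewrite /below /= !in_itv/= => p'c.
by move: z'p'; rewrite ler_norml => /andP[_]; lra.
Qed.

Lemma never_eq0 W z : measurable W ->
  (forall u, (0 <= u)%R -> locally_hits W u) ->
  (0 <= z)%R -> never mu W z = 0.
Proof.
move=> mW gW z0.
pose beta := (c + z + 1)%R.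
have [n [eps [eps0 H]]] := uniformly_hits beta mW gW.
apply: (@never_confined beta _ W mW n eps) => //.
- by move=> u ub; apply: return_everywhere => //; rewrite /beta; lra.
- by move=> u /andP[u0 ub]; apply: H; rewrite u0 ltW.
- by apply/andP; split => //; rewrite /beta; move: c_gt0; lra.
Qed.

End recurrence.

(** * Reachability in the non-lattice case *)

Lemma int_between02 (k : int) : (0 < k)%R -> (k < 2)%R -> k = 1%R.
Proof. lia. Qed.

Section reachability.
Context (R : realType) (S : set R).
Implicit Types (z u v r t g : R).
Hypothesis S_ge0 : forall y, S y -> (0 <= y)%R.

Inductive reach z : R -> Prop :=
| reach_refl : reach z z
| reach_step u y : reach z u -> S y -> reach z `|u - y|%R.

Variables (s : R) (Ss : S s) (s_gt0 : (0 < s)%R).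

(** Modulo [s], and up to sign, [z] reaches [r]. The sign is harmless: a step
    [s] exchanges [u] and [s - u] in [[0, s]]. *)
Definition hits z r := exists (k : int) u,
  [/\ reach z u, (0 <= u)%R & (u = r - k%:~R * s \/ u = k%:~R * s - r)%R].

Lemma hits_refl z : (0 <= z)%R -> hits z z.
Proof.
move=> z0; exists 0%R, z; split => //; first exact: reach_refl.
by left; rewrite mul0r subr0.
Qed.

Lemma hitsN z r : hits z r -> hits z (- r)%R.
Proof.
move=> [k [u [zu u0 ur]]]; exists (- k)%R, u; split => //.
by rewrite mulrNz; case: ur => ->; [right|left]; ring.
Qed.

Lemma reach_sub z u n : reach z u -> (n%:R * s <= u)%R ->
  reach z (u - n%:R * s)%R.
Proof.
have sgt := s_gt0; move=> zu; elim: n => [|n IH] nu;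
  first by rewrite mul0r subr0.
have h : (n%:R * s <= u)%R by move: nu; rewrite -natr1 mulrDl mul1r; lra.
have := reach_step (IH h) Ss; rewrite ger0_norm; last first.
  by move: nu; rewrite -natr1 mulrDl mul1r; lra.
by rewrite -natr1 mulrDl mul1r opprD addrA.
Qed.

(** Steps [s] bring the walk into [[0, s]]; one more step [s] chooses the sign.
*)
Lemma hits_reduce z r : hits z r -> exists (k : int) u,
  [/\ reach z u, (0 <= u <= s)%R & (u = k%:~R * s - r)%R].
Proof.
have sgt := s_gt0; move=> [k [u [zu u0 ur]]].
have us0 : (0 <= u / s)%R by rewrite divr_ge0// ltW.
have /andP[h1 h2] := truncn_itv us0.
pose n := Num.truncn (u / s).
have nu : (n%:R * s <= u)%R by rewrite -ler_pdivlMr.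
have un : (u < n%:R * s + s)%R by move: h2;
  rewrite -/n ltr_pdivrMr// -natr1 mulrDl mul1r.
have zv := reach_sub zu nu.
case: ur => ur; last first.
  exists (k - n%:Z)%R, (u - n%:R * s)%R; split => //.
    by apply/andP; split; lra.
  by rewrite {1}ur intrB/=; ring.
exists (k + n%:Z + 1)%R, (s - (u - n%:R * s))%R; split.
- have := reach_step zv Ss; rewrite distrC ger0_norm//; lra.
- by apply/andP; split; lra.
- by rewrite ur !intrD/=; ring.
Qed.

Lemma hitsD z r t : S t -> hits z r -> hits z (r + t)%R.
Proof.
move=> St /hits_reduce[k [u [zu /andP[u0 _] ur]]].
exists k, `|u - t|%R; split => //; first exact: reach_step.
have [ut|tu] := leP t u.
  by right; rewrite ger0_norm; [rewrite ur; ring|lra].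
by left; rewrite ltr0_norm; [rewrite ur; ring|lra].
Qed.

(** The translations that preserve reachability modulo [s] and sign form a
    subgroup of the reals, which contains [S]. *)
Definition shift g := forall z r, hits z r -> hits z (r + g)%R.

Lemma shift_S t : S t -> shift t.
Proof. by move=> St z r; exact: hitsD. Qed.

Lemma shiftN g : shift g -> shift (- g)%R.
Proof.
move=> Hg z r /hitsN /Hg /hitsN.
by rewrite opprD opprK.
Qed.

Lemma shiftD g h : shift g -> shift h -> shift (g + h)%R.
Proof. by move=> Hg Hh z r /Hg /Hh; rewrite addrA. Qed.

Lemma shift_int g (k : int) : shift g -> shift (k%:~R * g)%R.
Proof.
move=> Hg.
have Hn (n : nat) : shift (n%:R * g)%R.
  elim: n => [|n IH]; first by move=> z r; rewrite mul0r addr0.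
  by rewrite -natr1 mulrDl mul1r; exact: shiftD.
case: (intP k) => [|n|n]; first exact: (Hn 0%N).
  exact: (Hn n.+1).
by rewrite mulrNz mulNr; apply: shiftN; exact: (Hn n.+1).
Qed.

Hypothesis S_nl : ~ exists kappa : R,
  (0 < kappa)%R /\ S `<=` [set (kappa * n%:R)%R | n in [set: nat]].

(** A subgroup without small positive elements is generated by its least
    positive element [g], and then [S] is contained in the multiples of [g]. *)
Lemma shift_small (eps : R) : (0 < eps)%R ->
  exists2 g, shift g & (0 < g < eps)%R.
Proof.
move=> eps0; apply: contrapT => nex.
have big g : shift g -> (0 < g)%R -> (eps <= g)%R.
  move=> Hg g0; rewrite leNgt; apply/negP => ge; apply: nex.
  by exists g => //; rewrite g0.
pose E := [set g | shift g /\ (0 < g)%R].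
have Es : E s by split => //; exact: shift_S.
have lbE : has_inf E.
  by split; [exists s|exists 0%R => g [_ /ltW]].
have [g [Hg g0] gi] := inf_adherent eps0 lbE.
have gmin h : shift h -> (0 < h)%R -> (g <= h)%R.
  move=> Hh h0; rewrite leNgt; apply/negP => hg.
  have ih : (inf E <= h)%R by apply: ge_inf; [case: lbE|split].
  have : (eps <= g - h)%R.
    apply: big; last by rewrite subr_gt0.
    by apply: shiftD => //; exact: shiftN.
  lra.
apply: S_nl; exists g; split => // t St; exists (Num.truncn (t / g)) => //.
have t0 := S_ge0 St.
have tg0 : (0 <= t / g)%R by rewrite divr_ge0// ltW.
have /andP[h1 h2] := truncn_itv tg0.
set n := Num.truncn (t / g) in h1 h2 *.
have h1' : (n%:R * g <= t)%R by rewrite -ler_pdivlMr.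
have h2' : (t < n%:R * g + g)%R.
  by move: h2; rewrite ltr_pdivrMr// -natr1 mulrDl mul1r.
have Hd : shift (t - n%:R * g)%R.
  by apply: shiftD; [exact: shift_S|apply: shiftN; exact: (@shift_int g n)].
have [d0|d0] := ltP 0%R (t - n%:R * g)%R; last by rewrite mulrC; lra.
have := gmin _ Hd d0; lra.
Qed.

(** From [z], small shifts lead to a residue [r] just below [w], up to a
    multiple of [s] and to the sign; as [0 < r < s], a last step [s] reaches
    exactly [r]. *)
Lemma reach_dense z (w eps : R) : (0 <= z)%R -> (0 < w < s)%R -> (0 < eps)%R ->
  exists2 r, reach z r & (w - eps < r <= w)%R.
Proof.
have sgt := s_gt0; move=> z0 /andP[w0 ws] eps0.
have m0 : (0 < Num.min eps w)%R by rewrite lt_min eps0.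
have [g Hg /andP[g0]] := shift_small m0; rewrite lt_min => /andP[ge gw].
pose n := Num.floor ((w - z) / g)%R.
have h1 : (n%:~R * g <= w - z)%R by rewrite -ler_pdivlMr// floor_le.
have h2 : (w - z < n%:~R * g + g)%R.
  have := floorD1_gt ((w - z) / g)%R.
  by rewrite -/n ltr_pdivrMr// intrD mulrDl mul1r.
have := shift_int n Hg (hits_refl z0).
move=> /hits_reduce[k [u [zu /andP[u0 us] uE]]].
set r := (z + n%:~R * g)%R in uE *.
have rw : (r <= w)%R by rewrite /r; lra.
have wr : (w - g < r)%R by rewrite /r; lra.
have kE : (k%:~R * s = u + r)%R by rewrite uE; ring.
(* k * s = u + r lies strictly between 0 and 2 * s *)
have k1 : k = 1%R.
  have kp : (0 < k)%R.
    by rewrite -(@ltr0z R) -(pmulr_lgt0 _ s_gt0) kE; lra.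
  have k2 : (k < 2)%R.
    by rewrite -(@ltr_int R) -(ltr_pM2r s_gt0) kE; lra.
  exact: int_between02.
have us' : (u = s - r)%R by rewrite uE k1 mul1r.
exists r; last by rewrite rw andbT; lra.
have := reach_step zu Ss.
rewrite us' (_ : s - r - s = - r)%R; last by ring.
by rewrite normrN ger0_norm//; lra.
Qed.

End reachability.

(** * Every open interval of the state space can be reached *)

Section support.
Context (R : realType) (mu : probability R R).
Implicit Types (x y z : R).
Hypothesis mu_ge0 : mu `]-oo, 0%R[%classic = 0.
Hypothesis mu_nl : non_lattice mu.

Lemma supp_ge0 y : supp mu y -> (0 <= y)%R.
Proof.
move=> sy; rewrite leNgt; apply/negP => y0.
have := sy _ (@lray_open _ R 0%R); rewrite /= in_itv/= y0 => /(_ isT).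
by rewrite mu_ge0 ltxx.
Qed.

Lemma locally_hits_reach (W : set R) z u : measurable W ->
  reach (supp mu) z u -> locally_hits mu W u -> locally_hits mu W z.
Proof.
move=> mW; elim=> // {}u y zu IH sy gu; apply: IH; exact: locally_hits_step gu.
Qed.

(** As the interval lies in the state space, some increment [s] of the support
    exceeds its midpoint, and the points reachable from [z] are dense in
    [[0, s]]. *)
Lemma locally_hits_itv (a b z : R) : (a < b)%R ->
  `]a, b[%classic `<=` absorbing_set mu -> (0 <= z)%R ->
  locally_hits mu `]a, b[%classic z.
Proof.
move=> ab abC z0.
pose w := ((a + b) / 2)%R; pose w' := ((w + b) / 2)%R.
pose w0 := ((a + w) / 2)%R.
have [w0_ge0 _] : absorbing_set mu w0.
  by apply: abC; rewrite /= in_itv/= /w0 /w; apply/andP; split; lra.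
have [_ w'N] : absorbing_set mu w'.
  by apply: abC; rewrite /= in_itv/= /w' /w; apply/andP; split; lra.
have : w%:E < sup_supp mu.
  by apply: lt_le_trans w'N; rewrite lte_fin /w' /w; lra.
move=> /ereal_sup_gt[_ [s ss <-]]; rewrite lte_fin => ws.
have w_gt0 : (0 < w)%R by move: w0_ge0; rewrite /w0 /w; lra.
have s_gt0 : (0 < s)%R by exact: lt_trans w_gt0 ws.
have w0s : (0 < w < s)%R by rewrite w_gt0 ws.
have e0 : (0 < (b - a) / 2)%R by lra.
have [r zr /andP[r1 r2]] := reach_dense supp_ge0 ss s_gt0 mu_nl z0 w0s e0.
apply: (locally_hits_reach _ zr); first exact: measurable_itv.
apply: locally_hits_in; first exact: itv_open.
by rewrite /= in_itv/=; apply/andP; split; move: r1 r2; rewrite /w; lra.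
Qed.

Lemma supp_pos : exists2 s, supp mu s & (0 < s)%R.
Proof.
apply: contrapT => nex; apply: mu_nl; exists 1%R; split => // y sy.
exists 0%N => //; rewrite mulr0; apply/eqP; rewrite eq_le supp_ge0//=.
by rewrite leNgt; apply/negP => y0; apply: nex; exists y.
Qed.

Lemma tail_pos : exists2 c, (0 < c)%R & 0 < tail mu c.
Proof.
have [s ss s0] := supp_pos.
exists (s / 2)%R; first lra.
by apply: ss; [exact: rray_open|rewrite /= in_itv/= andbT; lra].
Qed.

End support.

(** * The Markov property of the reflected random walk *)

Section joint_law.
Context d (Omega : measurableType d) (R : realType) (P : probability Omega R).
Context (mu : probability R R).
Variables (F : set Omega) (mF : measurable F) (X Z : Omega -> R).
Hypotheses (mX : measurable_fun setT X) (mZ : measurable_fun setT Z).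

Let mXpre (A : set R) : measurable A -> measurable (X @^-1` A).
Proof. by move=> mA; rewrite -[X in measurable X]setTI; exact: mX. Qed.

Lemma integral_pushforward_restr (g : R -> \bar R) : measurable_fun setT g ->
  (forall x, 0 <= g x) ->
  \int[pushforward (mrestr P mF) X]_x g x = \int[P]_(w in F) g (X w).
Proof.
move=> mg g0.
rewrite -(integral_mrestr P mF (measurableT_comp mg mX)); last by move=> w;
  exact: g0.
exact: (@ge0_integral_pushforward _ _ _ _ _ X mX (mrestr P mF) setT g).
Qed.

Hypothesis indep : forall A B, measurable A -> measurable B ->
  P (F `&` X @^-1` A `&` Z @^-1` B) = P (F `&` X @^-1` A) * mu B.

(** On the event [F] the pair [(X, Z)] has the law of [X] on [F] times [mu], by
    uniqueness of product measures. *)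
Lemma integral_joint_law (h : R * R -> \bar R) : measurable_fun setT h ->
  (forall z, 0 <= h z) ->
  \int[P]_(w in F) h (X w, Z w) = \int[P]_(w in F) \int[mu]_y h (X w, y).
Proof.
move=> mh h0.
have mXZ : measurable_fun setT (fun w => (X w, Z w))
  by apply/measurable_fun_pairP.
pose k : {measure set R -> \bar R} :=
  @measure_function_pushforward__canonical__measure_function_Measure
    _ _ _ _ _ (mrestr P mF) X mX.
have kfin : k setT < +oo.
  apply: (@le_lt_trans _ _ 1); last exact: ltry.
  by apply: probability_le1; apply: measurableI => //; exact: mXpre.
pose k' := mfrestr measurableT kfin.
pose m : {measure set (R * R) -> \bar R} :=
  @measure_function_pushforward__canonical__measure_function_Measure
    _ _ _ _ _ (mrestr P mF) (fun w => (X w, Z w)) mXZ.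
have kk' A : k' A = k A by rewrite /k' /mfrestr /mrestr setIT.
have mE C : measurable C -> (k' \x mu) C = m C.
  apply: product_measure_unique => A B mA mB.
  transitivity (P (F `&` X @^-1` A `&` Z @^-1` B)).
    by congr (P _); apply/seteqP; split => w /=;
      [move=> [[] ? ? ?]|move=> [[] ? ? ?]].
  rewrite (indep mA mB); congr (_ * _).
  by apply: (etrans _ (esym (kk' A))); congr (P _); rewrite setIC.
have -> : \int[P]_(w in F) h (X w, Z w) = \int[m]_z h z.
  rewrite -(integral_mrestr P mF (measurableT_comp mh mXZ)); last by move=> w;
    exact: h0.
  exact/esym/(@ge0_integral_pushforward _ _ _ _ _ _ mXZ (mrestr P mF) setT h).
rewrite -(@eq_measure_integral _ _ _ setT m (k' \x mu) h);
  last by move=> A mA _; exact: mE.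
rewrite fubini_tonelli1//.
have mg := @measurable_fun_fubini_tonelli_F _ _ _ _ _ mu h mh h0.
rewrite -(integral_pushforward_restr mg); last by move=> x; exact: integral_ge0.
by apply: eq_measure_integral => A mA _; exact: kk'.
Qed.

End joint_law.

Section indep_event.
Context d (Omega : measurableType d) (R : realType) (P : probability Omega R).
Variables (F T : set Omega) (mF : measurable F) (mT : measurable T).
Variables (X : Omega -> R) (mX : measurable_fun setT X) (p : R)
  (p0 : (0 <= p)%R).
Hypothesis indep : forall A, measurable A ->
  P (F `&` X @^-1` A `&` T) = P (F `&` X @^-1` A) * p%:E.

Lemma integral_indep_event (g : R -> \bar R) :
  measurable_fun setT g -> (forall x, 0 <= g x) ->
  \int[P]_(w in F `&` T) g (X w) = \int[P]_(w in F) g (X w) * p%:E.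
Proof.
move=> mg g0.
have mFT : measurable (F `&` T) by exact: measurableI.
rewrite -(integral_pushforward_restr P mF mX mg g0).
rewrite -(integral_pushforward_restr P mFT mX mg g0).
pose k : {measure set R -> \bar R} :=
  @measure_function_pushforward__canonical__measure_function_Measure
    _ _ _ _ _ (mrestr P mF) X mX.
pose kT : {measure set R -> \bar R} :=
  @measure_function_pushforward__canonical__measure_function_Measure
    _ _ _ _ _ (mrestr P mFT) X mX.
rewrite muleC.
rewrite -[X in _ = X](@ge0_integral_mscale _ _ _ k setT measurableT (NngNum p0)
  g mg (fun x _ => g0 x)).
apply: (@eq_measure_integral _ _ _ setT (mscale (NngNum p0) k) kT) => A mA _.
transitivity (P (F `&` X @^-1` A `&` T)).
  by congr (P _); apply/seteqP; split => w /=;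
    [move=> [? [? ?]]|move=> [[] ? ? ?]].
rewrite indep// muleC; congr (_ * _).
by congr (P _); rewrite setIC.
Qed.

End indep_event.

Section markov.
Context d (Omega : measurableType d) (R : realType) (P : probability Omega R).
Context (mu : probability R R) (Y : nat -> {RV P >-> R}).
Hypothesis Y_iid : iid_with_law mu Y.
Variable x : R.
Local Notation X := (reflected_rw Y x).

Lemma measurable_rw n : measurable_fun setT (X n).
Proof.
elim: n => [|n IH] /=; first exact: measurable_cst.
by apply: measurableT_comp => //; apply: measurable_funB.
Qed.

Lemma rw_ge0 n w : (0 <= x)%R -> (0 <= X n w)%R.
Proof. by move=> x0; case: n => //=. Qed.

Let mY n : measurable_fun setT (Y n). Proof. by []. Qed.

Definition increments_in (s : seq nat) (B : nat -> set R) : set Omega :=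
  \bigcap_(i in [set` s]) (Y i @^-1` B i).

Lemma measurable_increments_in s B : (forall i, measurable (B i)) ->
  measurable (increments_in s B).
Proof.
move=> mB; apply: bigcap_measurableType => // i _.
by rewrite -[X in measurable X]setTI; exact: mY.
Qed.

(** The product rule for [F] and any finite family of increments of index at
    least [n]. Carrying all later increments along is what makes the property
    pass from [n] to [n.+1]. *)
Definition indep_future n (F : set Omega) := measurable F /\
  forall s B, uniq s -> (forall i, i \in s -> (n <= i)%N) ->
  (forall i, measurable (B i)) ->
  P (F `&` increments_in s B) = P F * \prod_(i <- s) mu (B i).

(** [F] together with the position at time [n] is independent of the increments
    still to come. *)
Definition adapted n (F : set Omega) :=
  forall A, measurable A -> indep_future n (F `&` X n @^-1` A).

Lemma adapted_measurable n F : adapted n F -> measurable F.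
Proof. by move=> /(_ setT measurableT)[]; rewrite preimage_setT setIT. Qed.

Lemma adapted0 : adapted 0 setT.
Proof.
move=> A mA.
have [xA|xA] := pselect (A x).
  have -> : setT `&` X 0 @^-1` A = setT by apply/seteqP; split.
  split => // s B us _ mB; rewrite setTI probability_setT mul1e.
  rewrite /increments_in Y_iid.1//; apply: eq_bigr => i _; exact: Y_iid.2.
have -> : setT `&` X 0 @^-1` A = set0 by apply/seteqP; split => // w [].
by split => // s B us _ mB; rewrite set0I measure0 mul0e.
Qed.

Lemma adaptedI n F D : measurable D -> adapted n F ->
  adapted n (F `&` X n @^-1` D).
Proof.
move=> mD HF A mA; rewrite -setIA -preimage_setI; apply: HF; exact: measurableI.
Qed.

Let mpre n (A : set R) : measurable A -> measurable (X n @^-1` A).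
Proof. by move=> mA; rewrite -[X in measurable X]setTI;
  exact: measurable_rw. Qed.

Lemma adapted_indep n F A B s (C : nat -> set R) : adapted n F ->
  uniq s -> (forall i, i \in s -> (n < i)%N) -> (forall i, measurable (C i)) ->
  measurable A -> measurable B ->
  P (F `&` increments_in s C `&` X n @^-1` A `&` Y n @^-1` B) =
  P (F `&` increments_in s C `&` X n @^-1` A) * mu B.
Proof.
move=> HF us sn mC mA mB.
have [_ HA] := HF _ mA.
have ns : n \notin s by apply/negP => /sn; rewrite ltnn.
(* the current increment is one more constraint on the future *)
pose C' i := if i == n then B else C i.
have mC' i : measurable (C' i) by rewrite /C'; case: ifP.
have CC' i : i \in s -> C' i = C i.
  by move=> si; rewrite /C' ifF//; apply/negbTE; apply: contraNneq ns => <-.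
have e1 : F `&` increments_in s C `&` X n @^-1` A `&` Y n @^-1` B =
    F `&` X n @^-1` A `&` increments_in (n :: s) C'.
  apply/seteqP; split => w /=.
    move=> [[[Fw fw] Xw] Yw]; split => // i /=; rewrite inE => /orP[/eqP ->|si].
      by rewrite /C' eqxx.
    by rewrite CC'//; exact: fw.
  move=> [[Fw Xw] fw]; split; last first.
    by have := fw n; rewrite /= inE eqxx /C' eqxx; exact.
  split => //; split => // i /= si.
  by have := fw i; rewrite /= inE si orbT CC'//; exact.
have e2 : F `&` increments_in s C `&` X n @^-1` A = F `&` X n @^-1` A `&`
  increments_in s C.
  by rewrite setIAC.
rewrite e1 e2 HA//=; last first.
- by move=> i; rewrite inE => /orP[/eqP ->|/sn/ltnW].
- by rewrite ns.
rewrite HA//; last by move=> i /sn/ltnW.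
rewrite big_cons {1}/C' eqxx -muleA [X in _ = _ * X]muleC; congr (_ * (_ * _)).
by rewrite !big_seq; apply: eq_bigr => i si; rewrite CC'.
Qed.

(** The event [X n.+1 \in A] is an event on the pair [(X n, Y n)], and on [F],
    with or without the constraint on the later increments, the law of this
    pair is a product with second factor [mu]. *)
Lemma adaptedS n F : adapted n F -> adapted n.+1 F.
Proof.
move=> HF A mA.
have mF := adapted_measurable HF.
pose h (z : R * R) : \bar R := (\1_A `|z.1 - z.2|%R)%:E.
have mh : measurable_fun setT h.
  by apply: (@measurable_dist_pair R (fun u => (\1_A u)%:E));
    exact: measurable_EFin_indic.
have h0 z : 0 <= h z by rewrite lee_fin.
pose g (u : R) := \int[mu]_y h (u, y).
have mg : measurable_fun setT g
  by exact: (measurable_fun_fubini_tonelli_F h mh h0).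
have g0 u : 0 <= g u by exact: integral_ge0.
have PE G : measurable G ->
    (forall A' B', measurable A' -> measurable B' ->
      P (G `&` X n @^-1` A' `&` Y n @^-1` B') = P (G `&` X n @^-1` A') * mu
        B') ->
    P (G `&` X n.+1 @^-1` A) = \int[P]_(w in G) g (X n w).
  move=> mG iG.
  rewrite -(integral_joint_law mG (measurable_rw n) (@mY n) iG mh h0).
  rewrite setIC -(integral_indic P mG (mpre n.+1 mA)).
  by apply: eq_integral => w _; rewrite !indicE.
split; first by apply: measurableI => //; exact: mpre.
move=> s B us sn mB.
have mT := measurable_increments_in s mB.
rewrite setIAC (PE (F `&` increments_in s B)); last 2 first.
- exact: measurableI.
- by move=> A' B' mA' mB'; exact: adapted_indep.
have pfin : \prod_(i <- s) mu (B i) \is a fin_num.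
  by apply: prode_fin_num => i _; exact: fin_num_measure.
have p0 : (0 <= fine (\prod_(i <- s) mu (B i)))%R.
  by apply: fine_ge0; apply: prode_ge0 => i _; exact: measure_ge0.
rewrite (PE F mF); last first.
  move=> A' B' mA' mB'; have := @adapted_indep n F A' B' [::] B HF.
  have -> : increments_in [::] B = setT by rewrite /increments_in set_nil
    bigcap_set0.
  by rewrite setIT; exact.
rewrite -(fineK pfin).
apply: (integral_indep_event mF mT (measurable_rw n) p0 _ mg g0) => A' mA'.
rewrite fineK//; have [_ HA] := HF _ mA'; apply: HA => // i /sn; exact: ltnW.
Qed.

Lemma adapted_step n F h : adapted n F -> measurable_fun setT h ->
  (forall z, 0 <= h z) ->
  \int[P]_(w in F) h (X n.+1 w) = \int[P]_(w in F) step_op mu h (X n w).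
Proof.
move=> HF mh h0; have mF := adapted_measurable HF.
apply: (integral_joint_law mF (measurable_rw n) (@mY n) _
  (measurable_dist_pair mh) (fun z => h0 _)).
move=> A' B' mA' mB'; have := @adapted_indep n F A' B' [::] (fun=> setT) HF.
have -> : increments_in [::] (fun=> setT) = setT by rewrite /increments_in
  set_nil bigcap_set0.
by rewrite setIT; exact.
Qed.

Definition avoids (W : set R) m k : set Omega :=
  [set w | forall i, (m <= i < m + k)%N -> ~ W (X i w)].

(** Induction on [k], moving the first avoided time into the event [F]. *)
Lemma avoids_prob W F m k : measurable W -> adapted m F ->
  measurable (F `&` avoids W m k) /\
  P (F `&` avoids W m k) = \int[P]_(w in F) avoid mu W k (X m w).
Proof.
move=> mW; elim: k m F => [|k IH] m F HF.
  have mF := adapted_measurable HF.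
  have -> : F `&` avoids W m 0 = F.
    apply/seteqP; split => w /=; first by case.
    move=> Fw; split => // i; rewrite addn0 => /andP[mi im].
    by have := leq_ltn_trans mi im; rewrite ltnn.
  by split => //=; rewrite integral_cst// mul1e.
have mWC : measurable (~` W) by exact: measurableC.
have HF' := adaptedI mWC HF.
have [m1 e1] := IH _ _ (adaptedS HF').
have eS : F `&` avoids W m k.+1 =
    F `&` X m @^-1` (~` W) `&` avoids W m.+1 k.
  apply/seteqP; split => w /=.
    move=> [Fw aw]; split; last by move=> i /andP[mi im]; apply: aw;
      rewrite ltnW// -addSnnS.
    by split => //; apply: aw; rewrite leqnn addnS ltnS leq_addr.
  move=> [[Fw Ww] aw]; split => // i /andP[];
    rewrite leq_eqVlt => /orP[/eqP <- //|mi im].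
  by apply: aw; rewrite mi addSnnS.
rewrite eS; split => //; rewrite e1.
rewrite (adapted_step HF' (measurable_avoid mu mW k) (avoid_ge0 mu W k)).
have mF := adapted_measurable HF.
rewrite integral_mkcondr; apply: eq_integral => w _.
rewrite epatch_indic /= muleC; congr (_ * _).
Qed.

End markov.

(** * The tail measure as an invariant Radon measure *)

Lemma measure_setT_null d (T : measurableType d) (R : realType)
    (m : {measure set T -> \bar R}) (A : set T) :
  measurable A -> m (~` A) = 0 -> m A = m setT.
Proof.
move=> mA mCA.
have mC : measurable (~` A) by exact: measurableC.
have := measureU m mA mC (setICr A); rewrite setUv => ->.
exact: (esym (etrans (f_equal (fun u => m A + u) mCA) (adde0 _))).
Qed.

Section support_measure.
Context (R : realType) (mu : probability R R).
Local Notation leb := (@lebesgue_measure R).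
Hypothesis mu_ge0 : mu `]-oo, 0%R[%classic = 0.

(** A point outside the support has a null neighbourhood, which can be taken
    with rational endpoints; there are countably many of these. *)
Lemma negligible_supp_compl : mu.-negligible (~` supp mu).
Proof.
pose F (n : nat) : set R := if @unpickle (rat * rat)%type n is Some pq then
  (if mu `]ratr pq.1, ratr pq.2[%classic == 0 then `]ratr pq.1, ratr
    pq.2[%classic else set0)
  else set0 :> set R.
have F0 n : mu.-negligible (F n).
  rewrite /F; case: (unpickle n) => [[p q]|]; last exact: negligible_set0.
  case: ifPn => [/eqP mu0|_]; last exact: negligible_set0.
  by exists `]ratr p, ratr q[%classic; split => //; exact: measurable_itv.
apply: negligibleS (negligible_bigcup F0) => x /=
  /existsNP[U /not_implyP[oU /not_implyP[Ux]]].
move=> /negP; rewrite -leNgt => muU.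
have /nbhs_ballP[r /= r0 rU] : nbhs x U by exact: open_nbhs_nbhs.
have [p] := @rat_in_itvoo R (x - r)%R x ltac:(lra);
  rewrite in_itv/= => /andP[p1 p2].
have [q] := @rat_in_itvoo R x (x + r)%R ltac:(lra);
  rewrite in_itv/= => /andP[q1 q2].
exists (pickle (p, q)); first exact: Logic.I.
rewrite /F pickleK ifT; first by rewrite /= in_itv/= p2.
rewrite -measure_le0; apply: le_trans muU; apply: le_measure; rewrite ?inE//.
  exact: open_measurable.
move=> y; rewrite /= in_itv/= => /andP[py yq]; apply: rU.
by rewrite /ball/= ltr_norml; apply/andP; split; lra.
Qed.

Lemma measurable_absorbing : measurable (absorbing_set mu).
Proof.
rewrite /absorbing_set (_ : [set x | _] = `[0%R, +oo[%classic `&`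
   [set x : R | x%:E <= sup_supp mu]).
  apply: measurableI => //; case: (sup_supp mu) => [N| |].
  - rewrite (_ : [set x | _] = `]-oo, N]%classic)//.
  - have -> : [set x : R | x%:E <= +oo] = setT; last exact: measurableT.
    by apply/seteqP; split => x //= _; rewrite leey.
  - have -> : [set x : R | x%:E <= -oo] = set0; last exact: measurable0.
    by apply/seteqP; split => x.
by apply/seteqP; split => x /=; rewrite in_itv/= andbT.
Qed.

Lemma ae_absorbing : {ae mu, forall y, absorbing_set mu y}.
Proof.
have H0 : mu.-negligible `]-oo, 0%R[%classic by exists `]-oo,
  0%R[%classic; split.
apply: negligibleS (negligibleU H0 negligible_supp_compl) => y /= /not_andP[|].
  by move=> /negP; rewrite -ltNge => y0; left; rewrite in_itv/=.
by move=> yN; right => sy; apply: yN; apply: ereal_sup_ubound; exists y.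
Qed.

Lemma tail_measure_absorbing_compl : tail_measure mu (~` absorbing_set mu) = 0.
Proof.
have mC := measurableC measurable_absorbing.
have mi := measurable_EFin_indic mC.
transitivity (\int[tail_measure mu]_x (\1_(~` absorbing_set mu) x)%:E).
  by rewrite (integral_indic (tail_measure mu) measurableT mC) setIT.
rewrite (integral_tail_measure_layer mu mi (@EFin_indic_ge0 _ _)).
pose G (y : R) := \int[leb]_(x in `[0%R, y[) (\1_(~` absorbing_set mu) x)%:E.
have G0 y : 0 <= G y by apply: integral_ge0 => x _; exact: EFin_indic_ge0.
have GE y : G y = landing (fun x => (\1_(~` absorbing_set mu) x)%:E) y 0.
  apply: eq_integral => x; rewrite inE /= in_itv/= => /andP[x0 _].
  by rewrite subr0 ger0_norm.
have mG : measurable_fun setT G.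
  rewrite (_ : G = (fun a => landing (fun x => (\1_(~` absorbing_set mu) x)%:E)
    a 0)); last by apply/funext => a; exact: GE.
  exact: (measurable_landing2 0%R mi (@EFin_indic_ge0 _ _)).
transitivity (\int[mu]_y (cst 0 y : \bar R)); last by rewrite integral0.
apply: (ge0_ae_eq_integral measurableT mG (measurable_cst _) (fun y _ => G0 y)
  (fun _ _ => lexx _)).
apply: filterS ae_absorbing => y [y0 yN] _.
apply: integral0_eq => x /=; rewrite in_itv/= => /andP[x0 xy].
rewrite indicE memNset//= => -[]; split => //.
by apply: le_trans yN; rewrite lee_fin ltW.
Qed.

Lemma integral_tail_measure_absorbing h : measurable_fun setT h ->
  (forall x, 0 <= h x) ->
  \int[tail_measure mu]_(x in absorbing_set mu) h x = \int[tail_measure mu]_x h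
    x.
Proof.
move=> mh h0.
rewrite [RHS](@ge0_negligible_integral _ _ _ (tail_measure mu)
  setT (~` absorbing_set mu))//.
- by rewrite setTD setCK.
- by apply: measurableC; exact: measurable_absorbing.
- exact: tail_measure_absorbing_compl.
Qed.

Lemma tail_measure_absorbing :
  tail_measure mu (absorbing_set mu) = tail_measure mu setT.
Proof.
apply: measure_setT_null; first exact: measurable_absorbing.
exact: tail_measure_absorbing_compl.
Qed.

Lemma tail_measure_invariant_radon c : (0 < c)%R -> 0 < tail mu c ->
  invariant_radon mu (tail_measure mu).
Proof.
move=> c0 tc; split.
- exact: tail_measure_absorbing_compl.
- rewrite tail_measure_absorbing gt_eqF//.
  apply: (@lt_le_trans _ _ (tail_measure mu `]0%R, c[%classic)).
    by apply: tail_measure_itv_gt0 => //; rewrite lexx.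
  by apply: le_measure; rewrite ?inE.
- move=> K cK.
  have mK : measurable K by apply: closed_measurable; exact: compact_closed.
  have [M [_ HM]] := compact_bounded cK.
  apply: le_lt_trans (tail_measure_below_lty mu (M + 1)%R).
  apply: le_measure; rewrite ?inE//; first exact: measurable_below.
  move=> y Ky; rewrite /below /= in_itv/=.
  have := HM (M + 1)%R; rewrite ltrDl => /(_ ltr01 y Ky) /=.
  by apply: le_trans; exact: ler_norm.
- move=> A mA.
  have mi := measurable_EFin_indic mA.
  transitivity (\int[tail_measure mu]_x (\1_A x)%:E).
    by rewrite (integral_indic (tail_measure mu) measurableT mA) setIT.
  rewrite -(tail_measure_invariant mu_ge0 mi (@EFin_indic_ge0 _ _)).
  rewrite -integral_tail_measure_absorbing; last 2 first.
    by apply: measurable_step_op => //; exact: EFin_indic_ge0.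
    by move=> x; apply: step_op_ge0; exact: EFin_indic_ge0.
  by apply: eq_integral => x _; rewrite (step_op_indic mu x mA).
Qed.

Definition positive_mean : \bar R := \int[mu]_y (Num.max y 0%R)%:E.

(** The total mass is the mean of [mu], by integrating the lengths of the
    intervals [[0, y[]. *)
Lemma tail_measure_setT : tail_measure mu setT = positive_mean.
Proof.
transitivity (\int[tail_measure mu]_x (cst 1 x : \bar R)).
  by rewrite (integral_cst (tail_measure mu) measurableT 1) mul1e.
rewrite (integral_tail_measure_layer mu (measurable_cst _)) => [|x];
  last exact: lee01.
apply: eq_integral => y _.
rewrite (integral_cst leb (measurable_itv _) 1) mul1e.
have L : lebesgue_measure (`[0%R, y[%classic : set R) = (Num.max y 0%R)%:E.
  rewrite lebesgue_measure_itv; have [y0|y0] := ltP 0%R y.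
    by rewrite /= lte_fin y0 sube0.
  by rewrite /= lte_fin ltNge y0.
exact: L.
Qed.

(** * A finite invariant measure forces a finite mean *)

Section lyapunov.
Variable lam : {measure set R -> \bar R}.
Hypothesis lam_inv : invariant_radon mu lam.
Hypothesis lam_fin : lam (absorbing_set mu) < +oo.

Let lam_setT : lam setT = lam (absorbing_set mu).
Proof.
case: lam_inv => l0 _ _ _.
by apply/esym/measure_setT_null => //; exact: measurable_absorbing.
Qed.

Let lamT_fin : lam setT < +oo. Proof. by rewrite lam_setT. Qed.

Let lam' := mfrestr measurableT lamT_fin.

Let lam'E A : lam' A = lam A.
Proof. by rewrite /lam' /mfrestr /mrestr setIT. Qed.

Lemma integral_invariant h : measurable_fun setT h -> (forall x, 0 <= h x) ->
  \int[lam]_x step_op mu h x = \int[lam]_x h x.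
Proof.
move=> mh h0.
have [l0 _ _ inv] := lam_inv.
pose m : {measure set R -> \bar R} :=
  @measure_function_pushforward__canonical__measure_function_Measure
    _ _ _ _ _ (lam' \x mu) _ (@measurable_dist R).
have mE A : measurable A -> lam A = m A.
  move=> mA; rewrite inv//.
  have mi := measurable_EFin_indic mA.
  have -> : m A = \int[lam']_x step_op mu (fun z => (\1_A z)%:E) x.
    apply: eq_integral => x _; rewrite (step_op_indic mu x mA)/=; congr (mu _).
    by apply/seteqP; split => y; rewrite /xsection/= inE.
  rewrite (@eq_measure_integral _ _ _ _ lam lam'); last by move=> B _ _;
    exact: lam'E.
  rewrite [RHS](@ge0_negligible_integral _ _ _ lam
    setT (~` absorbing_set mu))//.
  - rewrite setTD setCK; apply: eq_integral => x _.
    by rewrite (step_op_indic mu x mA).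
  - by apply: measurableC; exact: measurable_absorbing.
  - by apply: measurable_step_op => //; exact: EFin_indic_ge0.
  - by move=> x _; apply: step_op_ge0; exact: EFin_indic_ge0.
rewrite -(@eq_measure_integral _ _ _ setT lam m h); last by move=> A mA _;
  rewrite mE.
have -> : \int[m]_x h x = \int[lam' \x mu]_z h `|z.1 - z.2|%R.
  exact: (@ge0_integral_pushforward _ _ _ _ _ _ (@measurable_dist R)
    (lam' \x mu) setT h).
rewrite (fubini_tonelli1 _ (measurable_dist_pair mh) (fun z => h0 _)).
apply: (@eq_measure_integral _ _ _ setT lam' lam) => A mA _; exact/esym/lam'E.
Qed.

(** The positive part of [y], cut off at [L]: a bounded 1-Lipschitz test
    function that plays the role of a Lyapunov function. *)
Definition clip (L y : R) : R := Num.min (Num.max y 0%R) L.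

Lemma clip_ge0 (L y : R) : (0 <= L)%R -> (0 <= clip L y)%R.
Proof. by move=> L0; rewrite /clip le_min L0 le_max lexx orbT. Qed.

Lemma clip_le (L y : R) : (clip L y <= L)%R.
Proof. by rewrite /clip ge_min lexx orbT. Qed.

(** For the clipped values [u] and [v] this is [u + v - 2 min(u, v) = |u - v|],
    which is bounded both by [|x - y|] and by [L]. *)
Lemma clip_dist (L x y : R) : (0 <= L)%R ->
  (clip L x + clip L y <= clip L `|x - y| + 2 * Num.min (clip L x)
    (clip L y))%R.
Proof.
move=> L0; wlog xy : x y / (y <= x)%R.
  move=> H; have [xy|/ltW yx] := leP y x; first exact: H.
  by rewrite addrC distrC [Num.min _ _]minC; exact: H.
have cxy : (clip L y <= clip L x)%R.
  by rewrite /clip le_min !ge_min lexx orbT andbT; apply/orP; left;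
    rewrite ge_max !le_max xy lexx !orbT.
rewrite min_r// ger0_norm ?subr_ge0//.
suff : (clip L x <= clip L (x - y) + clip L y)%R by lra.
have a0 : (0 <= x - y)%R by rewrite subr_ge0.
rewrite /clip (max_l a0).
have b0 : (0 <= Num.max y 0)%R by rewrite le_max lexx orbT.
have cab : (Num.max x 0 <= x - y + Num.max y 0)%R.
  by rewrite ge_max addr_ge0// andbT -lerBlDl subKr le_max lexx.
move: (x - y)%R (Num.max y 0%R) (Num.max x 0%R) a0 b0 cab => p q r p0 q0 rpq.
by have [?|?] := leP r L; have [?|?] := leP p L; have [?|?] := leP q L; lra.
Qed.

Lemma clip_min_le (L k x y : R) : (0 <= k)%R -> (0 <= L)%R ->
  (Num.min (clip L x) (clip L y) <= clip k y + clip L y *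
    (\1_(`]k, +oo[%classic : set R) x))%R.
Proof.
move=> k0 L0; rewrite indicE.
case: (boolP (x \in _)) => /=; rewrite ?inE ?notin_setE /= in_itv/= andbT => xk.
  rewrite mulr1 ge_min; apply/orP; right.
  by rewrite lerDr clip_ge0.
move/negP: xk; rewrite -leNgt => xk; rewrite mulr0 addr0 /clip.
rewrite le_min; apply/andP; split; rewrite !ge_min; first by rewrite lexx !orbT.
by rewrite [(Num.max x 0 <= k)%R]ge_max xk k0.
Qed.

Lemma measurable_clip L : measurable_fun setT (fun y : R => (clip L y)%:E).
Proof.
apply/measurable_EFinP; apply: measurable_minr; last exact: measurable_cst.
by apply: measurable_maxr => //; exact: measurable_cst.
Qed.

Definition clip_mean (L : R) : \bar R := \int[mu]_y (clip L y)%:E.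

Lemma clip_mean_ge0 L : (0 <= L)%R -> 0 <= clip_mean L.
Proof. by move=> L0; apply: integral_ge0 => y _; rewrite lee_fin clip_ge0. Qed.

Lemma clip_mean_le L : (0 <= L)%R -> clip_mean L <= L%:E.
Proof.
move=> L0; rewrite -[leRHS](step_op_cst mu L%:E 0).
apply: ge0_le_integral => //.
- by move=> y _; rewrite lee_fin clip_ge0.
- exact: measurable_clip.
- by move=> y _; rewrite lee_fin clip_le.
Qed.

(** Integrating [clip_dist] against [mu] in [y] and [lam] in [x], the integrals
    of [clip L x] and of [clip L `|x - y|] agree by invariance and are finite,
    so they cancel; the minimum is then split according to [x <= k] or not. *)
Lemma clip_mean_bound (L k : R) : (0 <= k)%R -> (0 <= L)%R ->
  clip_mean L * lam setT <=
  2%:E * (clip_mean k * lam setT + clip_mean L * lam `]k, +oo[%classic).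
Proof.
move=> k0 L0.
pose c x := (clip L x)%:E.
pose g x := clip_mean k + clip_mean L * (\1_(`]k, +oo[%classic : set R) x)%:E.
have c0 x : 0 <= c x by rewrite lee_fin clip_ge0.
have mc : measurable_fun setT c by exact: measurable_clip.
have mI : measurable_fun setT (fun x :
  R => (\1_(`]k, +oo[%classic : set R) x : R)%:E).
  exact: measurable_EFin_indic.
have mL0 := clip_mean_ge0 L0; have mk0 := clip_mean_ge0 k0.
have mLI : measurable_fun setT (fun x :
  R => clip_mean L * (\1_(`]k, +oo[%classic : set R) x : R)%:E).
  by apply: emeasurable_funM => //; exact: measurable_cst.
have LI0 x : 0 <= clip_mean L * (\1_(`]k, +oo[%classic : set R) x : R)%:E.
  by rewrite mule_ge0// lee_fin.
have mg : measurable_fun setT g by apply: emeasurable_funD => //;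
  exact: measurable_cst.
have g0 x : 0 <= g x by rewrite /g adde_ge0.
have mQc : measurable_fun setT (step_op mu c) by exact: measurable_step_op.
have Qc0 x : 0 <= step_op mu c x by exact: step_op_ge0.
have two0 : 0 <= 2%:E :> \bar R by rewrite lee_fin.
have m2g : measurable_fun setT (fun x => 2%:E * g x).
  by apply: emeasurable_funM => //; exact: measurable_cst.
have point x : c x + clip_mean L <= step_op mu c x + 2%:E * g x.
  set i := (\1_(`]k, +oo[%classic : set R) x : R)%:E.
  have i0 : 0 <= i by rewrite lee_fin.
  have mck : measurable_fun setT (fun y : R => (clip k y)%:E)
    by exact: measurable_clip.
  have mci : measurable_fun setT (fun y : R => c y * i).
    by apply: emeasurable_funM => //; exact: measurable_cst.
  have ck0 y : 0 <= (clip k y)%:E by rewrite lee_fin clip_ge0.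
  have ci0 y : 0 <= c y * i by rewrite mule_ge0.
  have mb : measurable_fun setT (fun y : R => (clip k y)%:E + c y * i)
    by exact: emeasurable_funD.
  have b0 y : 0 <= (clip k y)%:E + c y * i by rewrite adde_ge0.
  have gE : g x = \int[mu]_y ((clip k y)%:E + c y * i).
    rewrite (ge0_integralD mu measurableT (fun y _ => ck0 y) mck
      (fun y _ => ci0 y) mci).
    by rewrite (@ge0_integralZr _ _ _ mu setT measurableT c mc i
      (fun y _ => c0 y) i0).
  have mcx : measurable_fun setT (fun y : R => c `|x - y|%R)
    by exact: measurable_step.
  have m2b : measurable_fun setT (fun y :
    R => 2%:E * ((clip k y)%:E + c y * i)).
    by apply: emeasurable_funM => //; exact: measurable_cst.
  rewrite gE -(@ge0_integralZl _ _ _ mu setT measurableT _ mb _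
    (fun y _ => b0 y) two0).
  rewrite /step_op -(ge0_integralD mu measurableT (fun y _ => c0 _) mcx
    (fun y _ => mule_ge0 two0 (b0 y)) m2b).
  rewrite addeC -(integralDcst mu mc c0 (c0 x)).
  apply: ge0_le_integral => //.
  - by move=> y _; rewrite adde_ge0.
  - by apply: emeasurable_funD => //; exact: measurable_cst.
  - exact: emeasurable_funD.
  - move=> y _; rewrite /c /i -EFinM -!EFinD lee_fin.
    have := clip_dist x y L0; have := clip_min_le x y k0 L0; lra.
pose K := \int[lam]_x c x.
have Kfin : K \is a fin_num.
  rewrite ge0_fin_numE; last exact: integral_ge0.
  apply: (@le_lt_trans _ _ (\int[lam]_x (cst L%:E x))).
    apply: (@ge0_le_integral _ _ _ lam setT measurableT _ _ (fun x _ => c0 x) mc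
      (measurable_cst _)).
    by move=> x _; rewrite lee_fin clip_le.
  by rewrite (integral_cst lam measurableT) lte_mul_pinfty// lee_fin.
have : K + clip_mean L * lam setT <= K + 2%:E * \int[lam]_x g x.
  rewrite [X in _ <= X + _](esym (integral_invariant mc c0) : K = _).
  rewrite -(integral_cst lam measurableT (clip_mean L)).
  rewrite -(@ge0_integralZl _ _ _ lam setT measurableT g mg _ (fun x _ => g0 x)
    two0).
  rewrite -(ge0_integralD lam measurableT (fun x _ => c0 x) mc (fun x _ => mL0)
    (measurable_cst _)).
  rewrite -(ge0_integralD lam measurableT (fun x _ => Qc0 x) mQc
    (fun x _ => mule_ge0 two0 (g0 x)) m2g).
  apply: ge0_le_integral => //.
  - by move=> x _; rewrite adde_ge0.
  - by apply: emeasurable_funD => //; exact: measurable_cst.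
  - exact: emeasurable_funD.
rewrite leeD2lE// => H; apply: (le_trans H).
apply: lee_wpmul2l => //.
rewrite (ge0_integralD lam measurableT (fun x _ => mk0) (measurable_cst _)
  (fun x _ => LI0 x) mLI).
rewrite (integral_cst lam measurableT (clip_mean k)).
rewrite (@ge0_integralZl _ _ _ lam setT measurableT _ mI _
  (fun x _ => EFin_indic_ge0 _ x) mL0).
by rewrite (integral_indic lam measurableT (measurable_itv _)) setIT.
Qed.

Lemma lam_tail_small (e : R) : (0 < e)%R ->
  exists n : nat, lam `]n%:R, +oo[%classic <= e%:E.
Proof.
move=> e0; apply: contrapT => /forallNP nex.
pose F (n : nat) : set R := `]n%:R, +oo[%classic.
have F0 : \bigcap_n F n = set0.
  apply/seteqP; split => // y /= /(_ (Num.truncn (Num.max y 0%R)).+1 Logic.I).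
  rewrite /F /= in_itv/= andbT => h.
  have := truncnS_gt (Num.max y 0%R).
  by move=> /lt_trans /(_ h); rewrite gt_max ltxx.
have cF : lam (F n) @[n --> \oo] --> 0.
  rewrite -[0](@measure0 _ _ _ lam) -F0; apply: nonincreasing_cvg_mu.
  - by apply: le_lt_trans lamT_fin; apply: le_measure; rewrite ?inE//;
      exact: measurable_itv.
  - by move=> n; exact: measurable_itv.
  - by rewrite F0.
  - by move=> n m nm; apply/subsetPset; apply: subset_itvr;
      rewrite bnd_simp ler_nat.
have : e%:E <= limn (fun n => lam (F n)).
  apply: lime_ge; first by apply/cvg_ex; exists 0.
  by apply: nearW => n; have := nex n => /negP; rewrite -ltNge => /ltW.
by rewrite (cvg_lim _ cF)// lee_fin leNgt e0.
Qed.

(** With [k] such that [lam] has at most a quarter of its mass above [k],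
    [clip_mean_bound] gives [clip_mean L <= 4 * clip_mean k] for all [L], and
    [clip_mean L] increases to the mean. *)
Lemma positive_mean_lty : positive_mean < +oo.
Proof.
have lamf : lam setT \is a fin_num by rewrite ge0_fin_numE.
pose t := fine (lam setT).
have tE : lam setT = t%:E by rewrite fineK.
have t0 : (0 < t)%R.
  rewrite -lte_fin -tE lt0e measure_ge0 andbT lam_setT.
  by case: lam_inv.
have [k kt] := @lam_tail_small (t / 4)%R ltac:(lra).
have k0 : (0 <= k%:R :> R)%R by [].
have cfin (L : nat) : clip_mean L%:R \is a fin_num.
  by rewrite ge0_fin_numE ?clip_mean_ge0//;
    apply: le_lt_trans (clip_mean_le _) _ => //; exact: ltry.
have bnd (L : nat) : clip_mean L%:R <= (4 * fine (clip_mean k%:R))%:E.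
  have := @clip_mean_bound L%:R k%:R k0 (ler0n _ _).
  have kf : lam `]k%:R, +oo[%classic \is a fin_num.
    by rewrite ge0_fin_numE//; apply: le_lt_trans kt _; exact: ltry.
  move: kt; rewrite -(fineK kf) tE -(fineK (cfin L)) -(fineK (cfin k)).
  have : (0 <= fine (clip_mean L%:R))%R by apply: fine_ge0;
    exact: clip_mean_ge0.
  move: (fine (clip_mean L%:R)) (fine (clip_mean k%:R)) (fine (lam _)) => mL mk
    l mL0.
  rewrite /= -!EFinM !lee_fin => lt4 h.
  rewrite -(ler_pM2r t0).
  have : (mL * l <= mL * (t / 4))%R by rewrite ler_wpM2l.
  lra.
have cm : clip_mean n%:R @[n --> \oo] --> positive_mean.
  have lE y : limn (fun n => (clip n%:R y)%:E) = (Num.max y 0%R)%:E.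
    apply: lim_near_cst => //; near=> n; rewrite /clip min_l//.
    by near: n; exact: nbhs_infty_ger.
  have -> : positive_mean = \int[mu]_y limn (fun n => (clip n%:R y)%:E).
    by apply: eq_integral => y _; rewrite lE.
  apply: (@cvg_monotone_convergence _ _ _ mu setT measurableT
    (fun n y => (clip n%:R y)%:E)).
  - by move=> n; exact: measurable_clip.
  - by move=> n y _; rewrite lee_fin clip_ge0.
  - by move=> y _ n m nm; rewrite lee_fin /clip le_min !ge_min lexx ler_nat nm
      orbT.
apply: (@le_lt_trans _ _ (4 * fine (clip_mean k%:R))%:E); last exact: ltry.
rewrite -(cvg_lim _ cm)//; apply: lime_le; first by apply/cvg_ex;
  exists positive_mean.
exact: nearW.
Unshelve. all: by end_near. Qed.

End lyapunov.
End support_measure.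

(** * Infinitely many visits *)

Section assembly.
Context d (Omega : measurableType d) (R : realType) (P : probability Omega R).
Context (mu : probability R R) (Y : nat -> {RV P >-> R}).
Local Notation leb := (@lebesgue_measure R).
Hypothesis Y_iid : iid_with_law mu Y.
Hypothesis Y_ge0 : forall n, {ae P, forall w, (0 <= Y n w)%R}.

Lemma law_negative : mu `]-oo, 0%R[%classic = 0.
Proof.
rewrite -(Y_iid.2 0%N _ (measurable_itv _)) /distribution /pushforward.
have [N [mN N0 sN]] := Y_ge0 0%N.
apply: (subset_measure0 _ mN _ N0).
  by rewrite -[X in measurable X]setTI; exact: measurable_funP.
by move=> w /=; rewrite in_itv/= => yw; apply: sN => /=; apply/negP;
  rewrite -ltNge.
Qed.

Lemma tail_distr_fun (x : R) : (0 <= x)%R ->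
  (1 - distr_fun mu x)%:E = tail mu x.
Proof.
move=> x0.
have m0 := law_negative.
have fin : mu `[0%R, x]%classic \is a fin_num by exact: fin_num_measure.
rewrite EFinB /distr_fun fineK// -(probability_setC mu (measurable_itv _)).
apply/eqP; rewrite eq_le; apply/andP; split; last first.
  apply: le_measure; rewrite ?inE//; first exact: measurableC.
  by move=> y; rewrite /= !in_itv/= andbT => xy; apply/negP;
    rewrite negb_and -!ltNge xy orbT.
rewrite -[leRHS]adde0 -m0; apply: (le_trans _ (measureU2 _ _ _)) => //.
apply: le_measure; rewrite ?inE//; [exact: measurableC|exact: measurableU|].
move=> y; rewrite /= !in_itv/= andbT => /negP;
  rewrite negb_and -!ltNge => /orP[|]; by [right|left].
Qed.

Lemma tail_square :
  \int[leb]_(x in `[0%R, +oo[) ((1 - distr_fun mu x) ^+ 2)%R%:E =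
  \int[leb]_(x in `[0%R, +oo[) (tail mu x * tail mu x).
Proof.
apply: eq_integral => x; rewrite inE /= in_itv/= andbT => x0.
by rewrite -(tail_distr_fun x0) -EFinM expr2.
Qed.

Lemma expectationE : 'E_P[Y 0%N] = positive_mean mu.
Proof.
rewrite expectation_def.
have mm : measurable_fun setT (fun y : R => (Num.max y 0%R)%:E).
  by apply/measurable_EFinP; apply: measurable_maxr => //;
    exact: measurable_cst.
transitivity (\int[P]_w ((fun y : R => (Num.max y 0%R)%:E) \o Y 0%N) w).
  apply: ae_eq_integral => //.
  - by apply/measurable_EFinP.
  - exact: measurableT_comp.
  - apply: filterS (Y_ge0 0%N) => w y0 _ /=.
    by rewrite max_l.
rewrite -ge0_integral_distribution//; last by move=> y;
  rewrite lee_fin le_max lexx orbT.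
by apply: eq_measure_integral => A mA _; exact: Y_iid.2.
Qed.

Section visits.
Variables (x : R) (x_ge0 : (0 <= x)%R) (W : set R) (mW : measurable W).
Hypothesis never0 : forall z, (0 <= z)%R -> never mu W z = 0.
Local Notation X := (reflected_rw Y x).

Definition avoids_from m : set Omega := \bigcap_k avoids Y x W m k.

Lemma measurable_avoids m k : measurable (avoids Y x W m k).
Proof.
have HF : adapted mu Y x m setT.
  elim: m => [|m IH]; [exact: adapted0|exact: adaptedS].
by have [] := avoids_prob k mW HF; rewrite setTI.
Qed.

Lemma avoids_from0 m : P (avoids_from m) = 0.
Proof.
have HF : adapted mu Y x m setT.
  elim: m => [|m IH]; [exact: adapted0|exact: adaptedS].
have mB : measurable (avoids_from m).
  by apply: bigcap_measurableType => k _; exact: measurable_avoids.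
have cv : \int[P]_w avoid mu W k (X m w) @[k --> \oo] --> \int[P]_w never mu W
  (X m w).
  apply: cvg_integral_le1.
  - by move=> k; apply: measurableT_comp;
      [exact: measurable_avoid|exact: measurable_rw].
  - by move=> k w; rewrite avoid_ge0 avoid_le1.
  - by move=> w; exact: cvg_avoid.
have z0 : \int[P]_w never mu W (X m w) = 0.
  by apply: integral0_eq => w _; apply: never0; exact: rw_ge0.
apply/eqP; rewrite -measure_le0 -[leRHS]z0 -(cvg_lim _ cv)//.
apply: lime_ge; first by apply/cvg_ex; eexists; exact: cv.
apply: nearW => k.
have [_ e] := avoids_prob k mW HF.
rewrite -e setTI; apply: le_measure; rewrite ?inE//;
  first exact: measurable_avoids.
by move=> w; apply.
Qed.

(** By the Markov property, the probability of no visit after time [m] is the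
    expectation of [never W] at the position at time [m], which is zero; almost
    surely there are then visits after every time, and the partial sums of the
    indicators are unbounded. *)
Lemma infinite_visits :
  P [set w | \sum_(0 <= n <oo) (\1_W (X n w) : R)%:E = +oo] = 1.
Proof.
set S := [set w | _].
have mf : measurable_fun setT (fun w => \sum_(0 <= n <oo)
  (\1_W (X n w) : R)%:E).
  apply: ge0_emeasurable_sum.
  - by move=> n w _ _; rewrite lee_fin.
  - move=> n _; apply: (measurableT_comp (measurable_EFin_indic mW)).
    exact: measurable_rw.
have mS : measurable S.
  have := mf measurableT [set +oo] (emeasurable_set1 _).
  by rewrite setTI.
rewrite -[S]setCK probability_setC; last exact: measurableC.
suff -> : P (~` S) = 0 by rewrite sube0.
have mB : measurable (\bigcup_m avoids_from m).
  apply: bigcupT_measurable => m; apply: bigcap_measurableType => k _.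
  exact: measurable_avoids.
have B0 : P (\bigcup_m avoids_from m) = 0.
  apply: measure_negligible => //; apply: negligible_bigcup => m.
  exists (avoids_from m); split => //; last exact: avoids_from0.
  by apply: bigcapT_measurable => k; exact: measurable_avoids.
apply: (subset_measure0 _ mB _ B0); first exact: measurableC.
move=> w Sw; apply: contrapT => nB; apply: Sw; rewrite /S/=.
have hit m : exists2 n, (m <= n)%N & W (X n w).
  apply: contrapT => nex; apply: nB; exists m => // k _ i /andP[mi _] Wi.
  by apply: nex; exists i.
have partial (K : nat) : exists n, K%:R%:E <= \sum_(0 <= i < n)
  (\1_W (X i w) : R)%:E.
  elim: K => [|K [n Kn]].
    by exists 0%N; rewrite big_nil.
  have [m nm Wm] := hit n.
  exists m.+1; rewrite big_nat_recr//= indicE mem_set//= -natr1 EFinD.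
  apply: leeD => //; apply: le_trans Kn _.
  by apply: lee_sum_nneg_natr => // i _ _; rewrite lee_fin.
apply/eqyP => A A0.
have [n Hn] := partial (Num.truncn A).+1.
apply: le_trans (le_trans Hn (nneseries_lim_ge _ _)); last by move=> i _ _;
  rewrite lee_fin.
by rewrite lee_fin ltW// truncnS_gt.
Qed.

End visits.
End assembly.

Theorem mainTheorem6 (R : realType) (d : measure_display)
    (Omega : measurableType d) (P : probability Omega R)
    (mu : probability R R) (Y : nat -> {RV P >-> R})
    (Y_iid : iid_with_law mu Y)
    (Y_ge0 : forall n, {ae P, forall w, (0 <= Y n w)%R})
    (Y_nonconstant : forall c : R, mu [set c] != 1)
    (mu_non_lattice : non_lattice mu)
    (sq_tail_integrable :
      \int[lebesgue_measure]_(x in `[0%R, +oo[)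
        ((1 - distr_fun mu x) ^+ 2)%R%:E < +oo)
    (x : R) (x_gt0 : (0 < x)%R) :
  [/\ topologically_recurrent mu Y x,
      'E_P[Y 0%N] < +oo -> positive_recurrent mu Y x &
      'E_P[Y 0%N] = +oo -> null_recurrent mu Y x].
Proof.
have mu0 := law_negative Y_iid Y_ge0.
have tsq := sq_tail_integrable; rewrite (tail_square Y_iid Y_ge0) in tsq.
have [c c0 tc] := tail_pos mu0 mu_non_lattice.
have rec : topologically_recurrent mu Y x.
  move=> a b ab abC.
  apply: (infinite_visits Y_iid (ltW x_gt0)); first exact: measurable_itv.
  move=> z z0; apply: (never_eq0 mu0 c0 tc tsq) => // u u0.
  exact: locally_hits_itv.
have inv := tail_measure_invariant_radon mu0 c0 tc.
split=> //.
- rewrite (expectationE Y_iid Y_ge0) => mfin; split=> //.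
  exists (tail_measure mu); split => //.
  by rewrite (tail_measure_absorbing mu0) tail_measure_setT.
- rewrite (expectationE Y_iid Y_ge0) => minf; split=> //.
    by exists (tail_measure mu).
  move=> lam lam_inv; apply/eqP; rewrite -leye_eq leNgt; apply/negP => lam_fin.
  by have := positive_mean_lty lam_inv lam_fin; rewrite minf ltxx.
Qed.
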